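(* Let $m\ge2$ and let $X\subset\{1,2,\dots,m\}^{\mathbb N}$ be a subshift, endowed with the metric $d_X(x,y)=\sum_{j=0}^\infty\frac{|x_j-y_j|}{\beta^j}$ for $x=(x_0,x_1,\dots),\,y=(y_0,y_1,\dots)\in X$, with some $\beta>1$. Let $f:X\to X$ be the left shift operator. Assume that $f$ satisfies the specification property. Then there is a residual subset $R$ of $X$ such that $$\lim_{\epsilon\to0}\frac{\log\log\mathscr E_x(\epsilon,f)}{-\log\epsilon}=\dim(X)\quad\text{for any }x\in R.$$
   Context: $\dim(X)$ is the box-counting dimension of $(X,d_X)$, i.e. the common value of $\limsup_{\epsilon\to0}\frac{\log N(\epsilon,X)}{-\log\epsilon}$ and $\liminf_{\epsilon\to0}\frac{\log N(\epsilon,X)}{-\log\epsilon}$, where $N(\epsilon,X)$ is the $\epsilon$-covering number of $X$ by closed balls (for subshifts these coincide, by Furstenberg's formula $\dim(X)=h_{\mathrm{top}}(f)/\log\beta$). $\mathcal P(X)$ is the space of Borel probability measures on $X$ with the first Wasserstein metric $d=W_1$, $W_1(\mu,\nu)=\inf_\pi\int d_X(x,y)\,d\pi(x,y)$, the infimum being over all couplings $\pi$ of $\mu$ and $\nu$. Empirical measures: $\delta_x^n=\frac1n\sum_{j=0}^{n-1}\delta_{f^j(x)}$. The pointwise emergence at scale $\epsilon>0$ at $x\in X$ is $$\mathscr E_x(\epsilon,f)=\min\Big\{N\in\mathbb N \mid \exists\,\{\mu_j\}_{j=1}^N\subset\mathcal P(X)\text{ with }\limsup_{n\to\infty}\min_{1\le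 j\le N}d(\delta_x^n,\mu_j)\le\epsilon\Big\}.$$ Specification property: for any $\epsilon>0$ there exists a constant $\tau(\epsilon)\ge0$ such that for any integer $K\ge1$, any points $p_1,\dots,p_K\in X$, and any positive integers $n_1,\dots,n_K$ and $m_1,\dots,m_K$ with $m_k-n_k\ge\tau(\epsilon)$ for $1\le k\le K$, there exists a periodic point $x\in X$ of period $N_K$ (i.e. $f^{N_K}(x)=x$) such that, with $N_k=\sum_{j=1}^k m_j$ and $N_0=0$, for every $1\le k\le K$, $$f^n(x)\in B_\epsilon(f^n(p_k))\quad\text{if } n\in[N_{k-1},N_{k-1}+n_k-1]\cap\mathbb Z,$$ where $B_r(y)$ is the ball of radius $r$ centered at $y$. *)

(* Defs.v *)
From HB Require Import structures.
From mathcomp Require Import all_boot all_order all_algebra.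
From mathcomp Require Import all_classical all_reals all_analysis.
From mathcomp Require Import borel_hierarchy.

Set Implicit Arguments.
Unset Strict Implicit.
Unset Printing Implicit Defensive.
Import Order.TTheory GRing.Theory Num.Theory.
Import numFieldNormedType.Exports.

Local Open Scope classical_set_scope.
Local Open Scope ring_scope.

(* A measurable type must be pointed in MathComp-Analysis, so Borel measures
   are only available on inhabited metric spaces. *)
#[short(type="pmetricType")]
HB.structure Definition PointedMetric (R : numDomainType) :=
  {M of Metric R M & Pointed M}.

Section subspace_metric.
Context {R : realType} {X : metricType R} (A : set X).

Definition sdist (x y : set_type A) : R := mdist (\val x) (\val y).

Fact sdist_ge0 x y : 0 <= sdist x y.
Proof. exact: mdist_ge0. Qed.

Fact sdist_positivity x y : sdist x y = 0 -> x = y.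
Proof. by move=> /mdist_positivity/val_inj. Qed.

Fact sdist_ballE (x : set_type A) d : ball x d = [set y | sdist x y < d].
Proof.
rewrite -[LHS]/(\val @^-1` ball (\val x) d) ballEmdist.
by apply/seteqP; split.
Qed.

HB.instance Definition _ :=
  PseudoMetric_isMetric.Build R (set_type A) sdist_ge0 sdist_positivity
    sdist_ballE.

End subspace_metric.

(* The value 0 is returned on the empty set. *)
Definition nat_min (A : set nat) : nat :=
  xget 0%N [set n | A n /\ forall k, A k -> (n <= k)%N].

Definition residual {T : topologicalType} (A : set T) : Prop :=
  exists2 G : set T, Gdelta_dense G & G `<=` A.

Section box_dimension.
Context (R : realType) (T : metricType R).

Definition covered_by (eps : R) (N : nat) : Prop :=
  exists c : 'I_N -> T, forall x, exists j, mdist (c j) x <= eps.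

Definition covering_number (eps : R) : nat := nat_min (covered_by eps).

Definition box_ratio (eps : R) : \bar R :=
  (ln (covering_number eps)%:R / - ln eps)%:E.

Definition upper_box_dim : \bar R := limf_esup box_ratio (0 : R)^'+.
Definition lower_box_dim : \bar R := limf_einf box_ratio (0 : R)^'+.

Definition has_box_dim (D : R) : Prop :=
  upper_box_dim = D%:E /\ lower_box_dim = D%:E.

End box_dimension.

Section wasserstein.
Context (R : realType) (T : pmetricType R).

Definition borel : Type := g_sigma_algebraType (@open T).
HB.instance Definition _ := Measurable.on borel.

(* The product sigma-algebra agrees with the Borel sigma-algebra of T * T when T
   is separable, in particular for subshifts. *)
Definition coupling (mu nu : probability borel R)
    (pi : probability (borel * borel)%type R) : Prop :=
  forall A : set borel, measurable A ->
    pi (A `*` setT) = mu A /\ pi (setT `*` A) = nu A.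

Definition W1 (mu nu : probability borel R) : \bar R :=
  ereal_inf [set (\int[pi]_z (mdist (z.1 : T) (z.2 : T))%:E)%E
            | pi in coupling mu nu].

End wasserstein.

Section emergence.
Context (R : realType) (T : pmetricType R) (f : T -> T).

(* [empirical n x] averages over n.+1 points (the empirical measure on 0 points
   is undefined), that is, it is $\delta_x^{n+1}$. *)
Definition empirical (n : nat) (x : T) : set (borel T) -> \bar R :=
  mscale (n.+1%:R^-1 : R)%:nng
    (msum (fun j => dirac (iter j f x : borel T)) n.+1).

HB.instance Definition _ n x := Measure.on (empirical n x).

Fact empirical_setT n x : empirical n x setT = 1%E.
Proof.
rewrite /empirical /mscale/= /msum.
rewrite (eq_bigr (fun=> 1%E)) => [|j _]; last exact: diracT.
by rewrite sumEFin sumr_const card_ord -EFinM mulVf// pnatr_eq0.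
Qed.

HB.instance Definition _ n x :=
  Measure_isProbability.Build _ _ _ (empirical n x) (empirical_setT n x).

Definition emergence_bound (x : T) (eps : R) (N : nat) : Prop :=
  (0 < N)%N /\ exists mu : 'I_N -> probability (borel T) R,
    (limn_esup (fun n => \big[mine/+oo]_(j < N) W1 (empirical n x) (mu j))
      <= eps%:E)%E.

Definition emergence (x : T) (eps : R) : nat := nat_min (emergence_bound x eps).

(* On its k-th time block the orbit of x shadows that of p k at the same absolute
   times i: both sides are iterated i times. *)
Definition specification : Prop :=
  forall eps : R, 0 < eps -> exists2 tau : R, 0 <= tau &
  forall (K : nat) (p : 'I_K -> T) (n m : 'I_K -> nat), (0 < K)%N ->
    (forall k, 0 < n k)%N -> (forall k, 0 < m k)%N ->
    (forall k, tau <= (m k)%:R - (n k)%:R) ->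
  let N k := (\sum_(j < K | (j < k)%N) m j)%N in
  exists x : T, iter (N K) f x = x /\
    forall (k : 'I_K) (i : nat), (N k <= i < N k + n k)%N ->
      ball (iter i f (p k)) eps (iter i f x).

End emergence.

(* The alphabet {1,...,m} is encoded by 'I_m = {0,...,m-1}; the metric only
   involves differences of symbols. *)
Definition full_shift (R : realType) (m : nat) (beta : R) & 1 < beta : Type :=
  nat -> 'I_m.

Section full_shift_metric.
Context (R : realType) (m : nat) (beta : R) (beta_gt1 : 1 < beta).
Local Notation FS := (full_shift m beta_gt1).

HB.instance Definition _ := Choice.copy FS (nat -> 'I_m).

Definition dist_term (x y : FS) (j : nat) : R :=
  `|(x j)%:R - (y j)%:R| / beta ^+ j.

Definition shift_dist (x y : FS) : R := limn (series (dist_term x y)).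

Fact beta_gt0 : 0 < beta. Proof. exact: lt_trans beta_gt1. Qed.

Fact dist_term_ge0 x y j : 0 <= dist_term x y j.
Proof. by rewrite divr_ge0// exprn_ge0// (ltW beta_gt0). Qed.

Fact dist_term_cvg x y : cvgn (series (dist_term x y)).
Proof.
have b0 := beta_gt0; apply: (@series_le_cvg _ _ (geometric m%:R beta^-1)) => //.
- by move=> n; exact: dist_term_ge0.
- by move=> n; rewrite /= mulr_ge0// exprn_ge0// invr_ge0 ltW.
- move=> n; rewrite /dist_term /geometric /= exprVn.
  rewrite ler_wpM2r ?invr_ge0 ?exprn_ge0 ?(ltW beta_gt0)//.
  have lem (i : 'I_m) : i%:R <= m%:R :> R by rewrite ler_nat ltnW.
  rewrite ler_norml; apply/andP; split.
    by rewrite lerBrDr addrC (@le_trans _ _ 0)// subr_le0.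
  by rewrite lerBlDr (le_trans (lem (x n)))// lerDl.
- apply: is_cvg_geometric_series.
  by rewrite gtr0_norm ?invr_gt0// invf_lt1.
Qed.

Fact shift_dist_xx x : shift_dist x x = 0.
Proof.
rewrite /shift_dist (_ : series _ = cst 0); first exact: norm_lim_cst.
apply/funext => n; rewrite /series/= big1// => j _.
by rewrite /dist_term subrr normr0 mul0r.
Qed.

Fact shift_dist_positivity x y : shift_dist x y = 0 -> x = y.
Proof.
move=> d0; apply/funext => j; apply/val_inj/eqP.
rewrite -(eqr_nat R) -subr_eq0 -normr_eq0; apply/eqP.
have b0 := beta_gt0; have : dist_term x y j <= 0.
  rewrite -d0 (@le_trans _ _ (series (dist_term x y) j.+1))//.
    rewrite seriesS lerDl /series/= sumr_ge0// => i _; exact: dist_term_ge0.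
  apply: nondecreasing_cvgn_le; last exact: dist_term_cvg.
  by apply/nondecreasing_seqP => n; rewrite seriesS lerDr dist_term_ge0.
rewrite /dist_term pmulr_lle0 ?invr_gt0 ?exprn_gt0// => le0.
by apply/eqP; rewrite eq_le le0/=.
Qed.

Fact shift_dist_sym x y : shift_dist x y = shift_dist y x.
Proof.
congr (limn _); apply/funext => n; apply: eq_bigr => j _.
by rewrite /dist_term distrC.
Qed.

Fact shift_dist_triangle y x z : shift_dist x z <= shift_dist x y + shift_dist y z.
Proof.
rewrite /shift_dist -limD; [|exact: dist_term_cvg|exact: dist_term_cvg].
apply: ler_lim; [exact: dist_term_cvg| |].
  by apply: is_cvgD; exact: dist_term_cvg.
near=> n; rewrite fctE -big_split/= ler_sum// => j _.
rewrite /dist_term -mulrDl ler_wpM2r ?invr_ge0 ?exprn_ge0 ?(ltW beta_gt0)//.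
exact: ler_distD.
Unshelve. all: by end_near. Qed.

HB.instance Definition _ :=
  isMetric.Build R FS shift_dist_xx shift_dist_positivity shift_dist_sym
    shift_dist_triangle.

Definition left_shift (x : FS) : FS := fun j => x j.+1.

Record subshift := Subshift {
  subshift_set : set FS;
  subshift_closed : closed subshift_set;
  subshift_invariant : forall x, subshift_set x -> subshift_set (left_shift x);
  subshift_nonempty : subshift_set !=set0 }.

Definition subshift_type (X : subshift) : Type := set_type (subshift_set X).

HB.instance Definition _ X := Metric.on (subshift_type X).

Definition subshift_point X : subshift_type X :=
  let: exist x Xx := cid (subshift_nonempty X) in exist _ x (mem_set Xx).

HB.instance Definition _ X :=
  isPointed.Build (subshift_type X) (subshift_point X).

Definition subshift_map (X : subshift) (x : subshift_type X) : subshift_type X :=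
  exist _ (left_shift (set_val x)) (mem_set (subshift_invariant (set_valP x))).

End full_shift_metric.

Arguments subshift_map {R m beta beta_gt1} X x.

Coercion subshift_type : subshift >-> Sortclass.

(* Main.v *)
From HB Require Import structures.
Require Import Defs.
From mathcomp Require Import all_boot all_order all_algebra.
From mathcomp Require Import all_classical all_reals all_analysis.
From mathcomp Require Import borel_hierarchy measurable_realfun.
From mathcomp Require Import ring lra zify.
Set Implicit Arguments.
Unset Strict Implicit.
Unset Printing Implicit Defensive.
Import Order.TTheory GRing.Theory Num.Theory.
Import numFieldNormedType.Exports.
Local Open Scope classical_set_scope.
Local Open Scope ring_scope.

(** Let W(n) be the number of words of length n of the subshift.  Two points are
    at distance about beta^-n when they first differ at the n-th symbol, so at
    scale beta^-n the covering number of X is W(n), up to a bounded shift of n.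
    By subadditivity (fekete) ln W(n) / n has a limit h, and the box dimension is
    D = h / ln beta.  It remains to show that ln ln of the emergence of a generic
    point at a scale eps with beta^-(n+1) < eps <= beta^-n is ln W(n) + O(ln n):
    division by - ln eps, which is about n ln beta, makes the error vanish
    (growth_exponent).

    Upper bound, at every point.  Up to an error of order beta^-n, an empirical
    measure is determined by the frequencies of the W(n) words of length n.
    Rounding these frequencies to multiples of 1/Q, with Q exponential in n, leaves
    at most (Q+1)^W(n) measures (emergence_bound_count), and the double logarithm
    of this number is ln W(n) + ln ln (Q+1) = ln W(n) + O(ln n).

    Lower bound, at generic points.  By specification every word of length n begins
    a point of period P = n + t, with t a constant.  Since an orbit of period P has
    at most P windows of length P, and distinct orbits have no common window, this
    gives at least W(n) / P orbits with pairwise disjoint sets of windows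
    (nwords_le_orbits).  Group 16 d of them in 8 d pairs: a string of 8 d bits
    selects one orbit per pair.  By specification again, a generic point x has, for
    each string, arbitrarily large times at which its empirical measure is almost
    equidistributed on the selected orbits (residual_generic_points).  A measure
    that is closer than a small multiple of beta^-P to such empirical measures for
    two strings forces these strings to differ in fewer than d positions
    (W1_gap_visits), and a Hamming ball of radius d contains at most 21^d of the
    256^d strings.  Hence at least 12^d measures are needed
    (generic_emergence_ge).  With d of the order of W(n) / n, the double logarithm
    is again ln W(n) + O(ln n).

    The Wasserstein distance enters only through two elementary bounds: an explicit
    coupling bounds it from above (W1_quantized), and the indicator of a set of
    windows bounds it from below (W1_ge_separated). *)

(** * Least elements and residual sets *)

Lemma nat_min_mem (A : set nat) k : A k -> A (nat_min A) /\ (nat_min A <= k)%N.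
Proof.
move=> Ak; have exA : exists n, `[< A n >] by exists k; exact/asboolP.
case: (ex_minnP exA) => n /asboolP An nmin.
rewrite /nat_min; case: xgetP => [p -> [Ap minp]|].
  by split=> //; exact: minp.
move=> /(_ n); case; split=> // j Aj; exact/nmin/asboolP.
Qed.

(** The conditions may be indexed by any countable type, the codes outside the
    image of [pickle] contributing the whole space. *)
Lemma residual_bigcap (T : topologicalType) (I : countType) (U : I -> set T) :
  (forall i, open (U i) /\ dense (U i)) -> residual (\bigcap_i U i).
Proof.
move=> oU; pose F n := if unpickle n is Some i then U i else setT.
exists (\bigcap_n F n).
  exists F => // n; rewrite /F; case: unpickle => [i|]; first exact: oU.
  by split; [exact: openT|move=> O O0 _; rewrite setIT].
by move=> x Fx i _; have := Fx (pickle i) Logic.I; rewrite /F pickleK.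
Qed.

(** * Binary codes *)

Definition hamming (n : nat) (s t : {ffun 'I_n -> bool}) : nat :=
  #|[pred i | s i != t i]|.

(** Weight a string [t] by 9 to the number of positions where it agrees with
    [s]: the weights sum to [(9 + 1) ^ (8 * d)], and each [t] of the ball has
    weight at least [9 ^ (7 * d)].  The number [8 * d] of positions is what makes
    [10 ^ 8 <= 21 * 9 ^ 7] give a bound well below [2 ^ 8] per unit of [d]. *)
Lemma hamming_ball_card (d : nat) (s : {ffun 'I_(8 * d) -> bool}) :
  (#|[pred t | hamming s t < d]| <= 21 ^ d)%N.
Proof.
set V := #|_|.
have tot : (\sum_(t : {ffun 'I_(8 * d) -> bool})
    \prod_i (if s i == t i then 9 else 1) = 10 ^ (8 * d))%N.
  rewrite -(bigA_distr_bigA (fun i b => if s i == b then 9 else 1)%N).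
  rewrite (eq_bigr (fun=> 10%N)) ?prod_nat_const ?card_ord// => i _.
  by rewrite big_bool; case: (s i).
have le : (V * 9 ^ (7 * d) <= 10 ^ (8 * d))%N.
  rewrite -tot -sum_nat_const [leqRHS](bigID (fun t => hamming s t < d)%N)/=.
  apply: leq_trans (leq_addr _ _).
  apply: leq_sum => t tV.
  rewrite (bigID [pred i | s i == t i])/= [X in (_ <= _ * X)%N]big1 => [|i /negbTE-> //].
  rewrite muln1 (eq_bigr (fun=> 9%N)) => [|i ->//].
  rewrite prod_nat_const leq_exp2l//.
  have := cardC [pred i | s i == t i]; rewrite card_ord.
  have -> : #|[predC [pred i | s i == t i]]| = hamming s t by apply: eq_card.
  move: (tV : (hamming s t < d)%N); move: (hamming s t) #|_| => u v; lia.
have powers : forall a b : nat, (a <= 21 * b -> a ^ d <= 21 ^ d * b ^ d)%N.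
  move=> a b ab; rewrite -expnMn.
  by case: (posnP d) => [->|d0]; rewrite ?expn0// leq_exp2r.
rewrite -(@leq_pmul2r (9 ^ (7 * d)))%N ?expn_gt0//.
apply: leq_trans le _; rewrite (expnM 10 8 d) (expnM 9 7 d); apply: powers.
lia.
Qed.

(** Each fiber lies in a Hamming ball, and [2 ^ 8 = 256 >= 12 * 21]. *)
Lemma code_fibers (d N : nat) (c : {ffun 'I_(8 * d) -> bool} -> 'I_N) :
  (forall s t, c s = c t -> (hamming s t < d)%N) -> (12 ^ d <= N)%N.
Proof.
move=> cP.
have : (#|{: {ffun 'I_(8 * d) -> bool}}| <= N * 21 ^ d)%N.
  rewrite -[leqLHS]sum1_card (partition_big c xpredT)//=.
  rewrite -[X in (_ <= X * _)%N]card_ord -sum_nat_const leq_sum// => j _.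
  rewrite sum1dep_card.
  have [s sj|none] := pickP (fun s => c s == j).
    apply: leq_trans (hamming_ball_card s).
    apply: subset_leq_card; apply/fintype.subsetP => t; rewrite !inE => /eqP tj.
    by apply: cP; rewrite tj (eqP sj).
  by rewrite eq_card0// => s; rewrite !inE none.
rewrite card_ffun card_bool card_ord expnM => le.
rewrite -(@leq_pmul2r (21 ^ d))%N ?expn_gt0// -expnMn.
apply: leq_trans le; case: (posnP d) => [->|d0]; first by rewrite !expn0.
by rewrite leq_exp2r.
Qed.

(** * Exponential growth rates *)

(** Fekete's subadditive lemma: writing [n] as a multiple of [k] plus a remainder
    gives [a n <= (n / k) * a k + O(1)], so the limit is the infimum of the
    [a k / k]. *)
Lemma fekete (R : realType) (a : R^nat) :
  (forall n, 0 <= a n) -> (forall n k, a (n + k)%N <= a n + a k) ->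
  cvgn (fun n => a n / n%:R).
Proof.
move=> a0 aD.
pose S := [set a n.+1 / n.+1%:R | n in [set: nat]].
have S_ge0 x : S x -> 0 <= x by move=> [n _ <-]; rewrite divr_ge0.
have hasS : has_inf S by split; [exists (a 1%N / 1%:R); exists 0%N|exists 0].
have infS x : S x -> inf S <= x by apply: ge_inf; exists 0.
have aM n q : a (q * n)%N <= q%:R * a n + a 0%N.
  elim: q => [|q IH]; first by rewrite mul0n mul0r add0r.
  by rewrite mulSn (le_trans (aD _ _))// -natr1 mulrDl mul1r; lra.
apply/cvg_ex; exists (inf S); apply/cvgrPdist_le => e e0.
have e20 : 0 < e / 2 by lra.
have [_ [k _ <-] kS] := inf_adherent e20 hasS.
set b := a k.+1 / k.+1%:R in kS.
pose M := a 0%N + \sum_(r < k.+1) a r.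
have M_ge0 : 0 <= M by rewrite addr_ge0// sumr_ge0.
have aM1 n : a n <= n%:R * b + M.
  rewrite {1}(divn_eq n k.+1); apply: le_trans (aD _ _) _.
  have le1 : a (n %% k.+1)%N <= \sum_(r < k.+1) a r.
    have lt : (n %% k.+1 < k.+1)%N by rewrite ltn_mod.
    by rewrite (bigD1 (Ordinal lt))//= lerDl sumr_ge0.
  have le2 : (n %/ k.+1)%:R * a k.+1 <= n%:R * b.
    rewrite /b mulrCA [leLHS]mulrC ler_wpM2l// ler_pdivlMr// -natrM ler_nat.
    exact: leq_trunc_div.
  by have := aM k.+1 (n %/ k.+1)%N; rewrite /M; lra.
near=> n.
have n0 : (0 < n)%N by near: n; exact: nbhs_infty_gt.
have n0R : 0 < n%:R :> R by rewrite ltr0n.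
have Mn : M / (e / 2) <= n%:R by near: n; exact: nbhs_infty_ger.
have : inf S <= a n / n%:R by apply: infS; exists n.-1 => //; rewrite prednK.
have : a n / n%:R <= b + e / 2.
  rewrite ler_pdivrMr//; move: Mn; rewrite ler_pdivrMr// => Mn.
  by have := aM1 n; lra.
by rewrite ler_norml; lra.
Unshelve. all: by end_near. Qed.

Lemma cvg_ln_div (R : realType) (c : R) :
  (c + ln n%:R) / n%:R @[n --> \oo] --> (0 : R).
Proof.
apply/cvgrPdist_le => e e0.
near=> n.
have n0 : (0 < n)%N by near: n; exact: nbhs_infty_gt.
have n0R : 0 < n%:R :> R by rewrite ltr0n.
have s0 : 0 < Num.sqrt (n%:R : R) by rewrite sqrtr_gt0.
have sn : Num.sqrt n%:R ^+ 2 = n%:R :> R by rewrite sqr_sqrtr// ltW.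
have lns : ln n%:R <= 2 * Num.sqrt (n%:R : R).
  have := ln_sublinear s0; rewrite -[in leLHS]sn lnXn// mulr2n; lra.
have ln0 : 0 <= ln (n%:R : R) by rewrite ln_ge0// ler1n.
have cn : `|c| * 2 / e <= n%:R by near: n; exact: nbhs_infty_ger.
have en : (4 / e) ^+ 2 <= n%:R by near: n; exact: nbhs_infty_ger.
have es : 4 / e <= Num.sqrt (n%:R : R).
  by rewrite -sn ler_pXn2r// ?nnegrE ?(ltW s0)// divr_ge0// ltW in en.
rewrite sub0r normrN normrM [X in _ * X]ger0_norm ?invr_ge0//.
rewrite ler_pdivrMr//.
apply: le_trans (ler_normD _ _) _; rewrite (ger0_norm ln0).
move: cn es; rewrite !ler_pdivrMr// => cn es.
have : 4 * Num.sqrt n%:R <= e * (n%:R : R).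
  rewrite -[in leRHS]sn expr2 mulrA ler_wpM2r ?(ltW s0)//; lra.
lra.
Unshelve. all: by end_near. Qed.

(** Shells *)
(** The scales are sorted into the shells [beta ^- n.+1 < eps <= beta ^- n], on
    which [- ln eps] is [n * ln beta] up to a bounded error.  A quantity that
    follows [a n] on the [n]-th shell up to [O(ln n)] then has the growth exponent
    of [a], because [ln n / n] tends to 0; all the estimates below, for covering
    numbers and for emergence, have this form. *)
Lemma growth_exponent (R : realType) (beta : R) (a : R^nat) (h c : R)
    (n0 : nat) (F : R -> R) :
  1 < beta -> a n / n%:R @[n --> \oo] --> h ->
  (forall n eps, (n0 <= n)%N -> beta ^- n.+1 < eps <= beta ^- n ->
     `|F eps - a n| <= c + ln n%:R) ->
  F eps / - ln eps @[eps --> 0^'+] --> h / ln beta.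
Proof.
move=> b1 ah aF.
have b0 : 0 < beta by lra.
have lb0 : 0 < ln beta by rewrite ln_gt0.
pose t (eps : R) := - ln eps / ln beta.
(* [N eps] is the index of the shell that contains [eps]. *)
pose N eps := Num.truncn (t eps).
have shell eps : 0 < eps -> eps < 1 -> beta ^- (N eps).+1 < eps <= beta ^- (N eps).
  move=> e0 e1; have t0 : 0 <= t eps.
    by rewrite divr_ge0 ?(ltW lb0)// oppr_ge0 ln_le0// ltW.
  have /andP[Nt tN] := truncn_itv t0.
  have xp k : 0 < beta ^- k by rewrite invr_gt0 exprn_gt0.
  have lnx k : ln (beta ^- k) = - (k%:R * ln beta).
    by rewrite lnV ?posrE ?exprn_gt0// lnXn// mulr_natl.
  have et : ln eps = - (t eps * ln beta).
    by rewrite /t divfK ?gt_eqF// opprK.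
  rewrite -ltr_ln ?posrE// -ler_ln ?posrE// !lnx et ltrN2 lerN2.
  by rewrite ltr_pM2r// ler_pM2r// Nt tN.
have Noo : N eps @[eps --> (0:R)^'+] --> \oo.
  apply/cvgnyPge => M; near=> eps.
  have e0 : 0 < eps by near: eps; exact: nbhs_right_gt.
  have eM : eps < beta ^- M.
    by near: eps; apply: nbhs_right_lt; rewrite invr_gt0 exprn_gt0.
  have e1 : eps < 1 by near: eps; exact: nbhs_right_lt.
  rewrite leqNgt; apply/negP => NM.
  have /andP[+ _] := shell _ e0 e1; rewrite ltNge => /negP; apply.
  rewrite (le_trans (ltW eM))// lef_pV2 ?posrE ?exprn_gt0// ler_weXn2l ?ltW//.
have comp (u : R^nat) (l : R) : u n @[n --> \oo] --> l ->
    u (N eps) @[eps --> (0:R)^'+] --> l by exact: cvg_comp.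
have Fa : (F eps - a (N eps)) / (N eps)%:R @[eps --> (0:R)^'+] --> (0 : R).
  have /comp/= up := cvg_ln_div c.
  apply: (@squeeze_cvgr _ _ _ _ (fun eps => - ((c + ln (N eps)%:R) / (N eps)%:R))
    (fun eps => (c + ln (N eps)%:R) / (N eps)%:R)) => //; last first.
    by rewrite -[X in _ --> X]oppr0; exact: cvgN.
  near=> eps.
  have e0 : 0 < eps by near: eps; exact: nbhs_right_gt.
  have e1 : eps < 1 by near: eps; exact: nbhs_right_lt.
  have Nn0 : (n0 <= N eps)%N by near: eps; exact: (proj1 (cvgnyPge _) Noo).
  rewrite -ler_norml normrM [X in _ * X]ger0_norm ?invr_ge0//.
  by rewrite ler_wpM2r ?invr_ge0// aF// shell.
have Nt1 : (N eps)%:R / t eps @[eps --> (0:R)^'+] --> (1 : R).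
  have /comp low : 1 - n.+1%:R^-1 @[n --> \oo] --> (1 : R).
    rewrite -[X in _ --> X]subr0; apply: cvgB; first exact: cvg_cst.
    exact: cvg_harmonic.
  apply: (@squeeze_cvgr _ _ _ _ (fun eps => 1 - (N eps).+1%:R^-1) (fun=> 1)) => //;
    last exact: cvg_cst.
  near=> eps.
  have e0 : 0 < eps by near: eps; exact: nbhs_right_gt.
  have e1 : eps < 1 by near: eps; exact: nbhs_right_lt.
  have t0 : 0 < t eps.
    by rewrite divr_gt0// oppr_gt0 ln_lt0// e0.
  have /andP[Nt tN] := truncn_itv (ltW t0).
  rewrite ler_pdivlMr// ler_pdivrMr// mul1r Nt andbT.
  have tN' : t eps <= (N eps).+1%:R by exact: ltW.
  have -> : 1 - (N eps).+1%:R^-1 = (N eps)%:R / (N eps).+1%:R :> R.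
    by rewrite -natr1; field; rewrite natr1 pnatr_eq0.
  by rewrite mulrAC ler_pdivrMr// ler_wpM2l.
have lim : ((F eps - a (N eps)) / (N eps)%:R + a (N eps) / (N eps)%:R)
    * ((N eps)%:R / t eps) * (ln beta)^-1 @[eps --> (0:R)^'+]
    --> (0 + h) * 1 * (ln beta)^-1.
  apply: cvgM; last exact: cvg_cst.
  by apply: cvgM => //; apply: cvgD => //; exact: comp _ _ ah.
rewrite add0r mulr1 in lim.
apply: (cvg_trans _ lim); apply: near_eq_cvg.
near=> eps.
have e0 : 0 < eps by near: eps; exact: nbhs_right_gt.
have e1 : eps < 1 by near: eps; exact: nbhs_right_lt.
have l0 : ln eps < 0 by rewrite ln_lt0// e0.
have N0 : (0 < N eps)%N by near: eps; exact: (proj1 (cvgnyPge _) Noo).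
rewrite /= /t; field.
by rewrite (lt_eqF l0) (gt_eqF lb0) gt_eqF ?ltr0n.
Unshelve. all: by end_near. Qed.

Lemma cvg_limf_esup (R : realType) (T : choiceType) (X : filteredType T)
    (F : set_system X) (PF : ProperFilter F) (f : X -> R) (D : R) :
  f @ F --> D -> limf_esup (fun x => (f x)%:E) F = D%:E.
Proof.
move=> fD; apply/eqP; rewrite eq_le; apply/andP; split.
  apply/lee_addgt0Pr => e e0; apply: ereal_inf_le.
  exists (ereal_sup [set (f x)%:E | x in [set x | `|D - f x| <= e]]).
    exists [set x | `|D - f x| <= e] => //.
    by have /cvgrPdist_le := fD; exact.
  apply: ge_ereal_sup => _ [x /= + <-]; rewrite ler_norml -EFinD lee_fin; lra.
apply: le_ereal_inf_tmp => _ [V FV <-].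
apply/lee_addgt0Pr => e e0; rewrite -leeBlDr//.
have /cvgrPdist_le/(_ e e0) FV' := fD.
have [x [Vx]] := filter_ex (filterI FV FV').
rewrite /= ler_norml => /andP[h1 h2].
apply: le_ereal_sup_tmp; exists (f x)%:E; first by exists x.
by rewrite -EFinB lee_fin; lra.
Qed.

(** * Words of a subshift and its box dimension *)

Section subshift_words.
Context {R : realType} {m : nat} {beta : R} {beta_gt1 : 1 < beta}.
Variable X : subshift m beta_gt1.

Let beta_gt0 : 0 < beta. Proof. exact: lt_trans beta_gt1. Qed.

Lemma pow_unbounded (K : R) : exists s : nat, K <= beta ^+ s.
Proof.
exists (Num.truncn (ln K / ln beta)).+1.
have [K0|K0] := leP K 0; first by rewrite (le_trans K0)// exprn_ge0// ltW.
rewrite -ler_ln ?posrE ?exprn_gt0// lnXn// -[leRHS]mulr_natl -ler_pdivrMr ?ln_gt0//.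
exact/ltW/truncnS_gt.
Qed.

Definition coord (x : X) (i : nat) : 'I_m := set_val x i.

Lemma coord_iter j (x : X) i : coord (iter j (subshift_map X) x) i = coord x (j + i)%N.
Proof. by elim: j i => //= j IH i; rewrite addSnnS -IH. Qed.

Lemma coord_inj (x y : X) : (forall i, coord x i = coord y i) -> x = y.
Proof. by move=> xy; apply/val_inj/funext. Qed.

Lemma mdistE (x y : X) : mdist x y = shift_dist (set_val x) (set_val y).
Proof. by []. Qed.

Lemma mdist_ge_coord (x y : X) i n :
  (i <= n)%N -> coord x i != coord y i -> beta ^- n <= mdist x y.
Proof.
move=> le_in neq; rewrite mdistE.
set u := dist_term (set_val x) (set_val y).
have u0 j : 0 <= u j by exact: dist_term_ge0.
apply: (@le_trans _ _ (u i)); last first.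
  apply: (@le_trans _ _ (series u i.+1)).
    by rewrite seriesS lerDl /series/= sumr_ge0.
  apply: nondecreasing_cvgn_le; last exact: dist_term_cvg.
  by apply/nondecreasing_seqP => n'; rewrite seriesS lerDr.
apply: (@le_trans _ _ (beta ^- i)).
  by rewrite lef_pV2 ?posrE ?exprn_gt0// ler_weXn2l// ltW.
rewrite /u /dist_term ler_pMl ?invr_gt0 ?exprn_gt0//.
have : (set_val x i : nat) != set_val y i by [].
rewrite neq_ltn => /orP[lt|lt].
  by rewrite distrC -natrB ?(ltnW lt)// normr_nat ler1n subn_gt0.
by rewrite -natrB ?(ltnW lt)// normr_nat ler1n subn_gt0.
Qed.

(** The sum of the series of the [m / beta ^ j], a bound on the diameter. *)
Definition diam_bound : R := m%:R * beta / (beta - 1).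

Lemma diam_bound_ge0 : 0 <= diam_bound.
Proof. by rewrite divr_ge0 ?mulr_ge0// ?ltW// subr_gt0. Qed.

Lemma mdist_le_coord (x y : X) n :
  (forall i, (i < n)%N -> coord x i = coord y i) ->
  mdist x y <= diam_bound * beta ^- n.
Proof.
move=> xy; rewrite mdistE.
set u := dist_term (set_val x) (set_val y).
(* The tail that remains after [n + k] terms is kept on the left, which makes
   the bound provable by induction on [k]. *)
have bound k : series u (n + k)%N + diam_bound * beta ^- (n + k)
    <= diam_bound * beta ^- n.
  elim: k => [|k IH].
    rewrite addn0 /series/= big_nat big1 ?add0r// => j jn.
    rewrite /u /dist_term (_ : set_val x j = set_val y j) ?subrr ?normr0 ?mul0r//.
    exact: xy.
  apply: le_trans IH; rewrite addnS seriesS [u _ + _]addrC -addrA lerD2l.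
  have uk : u (n + k)%N <= m%:R * beta ^- (n + k).
    rewrite /u /dist_term ler_wpM2r ?invr_ge0 ?exprn_ge0 ?(ltW beta_gt0)//.
    set a := set_val x _; set b := set_val y _.
    have : a%:R <= m%:R :> R by rewrite ler_nat ltnW.
    have : b%:R <= m%:R :> R by rewrite ler_nat ltnW.
    have : 0 <= a%:R :> R by [].
    have : 0 <= b%:R :> R by [].
    by rewrite ler_norml; lra.
  have step : diam_bound * beta ^- (n + k) =
      m%:R * beta ^- (n + k) + diam_bound * beta ^- (n + k).+1.
    rewrite /diam_bound exprS; field.
    by rewrite expf_neq0 ?gt_eqF ?subr_gt0.
  by rewrite step lerD2r.
apply: limr_le; first exact: dist_term_cvg.
near=> N; have nN : (n <= N)%N by near: N; exact: nbhs_infty_ge.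
have := bound (N - n)%N; rewrite subnKC//; apply: le_trans.
by rewrite lerDl mulr_ge0 ?diam_bound_ge0// invr_ge0 exprn_ge0// ltW.
Unshelve. all: by end_near. Qed.

(** The first [n] symbols of a point, as an arbitrary string.  Sets of such strings
    form a finite type that depends on [n] only, whereas [prefix] below lands in
    the words of [X], which are the strings to be counted. *)
Definition win n (x : X) : {ffun 'I_n -> 'I_m} := [ffun i : 'I_n => coord x i].

Lemma winP n (x y : X) :
  win n x = win n y <-> (forall i, (i < n)%N -> coord x i = coord y i).
Proof.
split=> [/ffunP xy i lt|xy].
  by have := xy (Ordinal lt); rewrite !ffunE.
by apply/ffunP => i; rewrite !ffunE xy.
Qed.

Definition is_word n (w : {ffun 'I_n -> 'I_m}) : bool :=
  `[< exists x : X, win n x = w >].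

Definition word n := {w : {ffun 'I_n -> 'I_m} | is_word w}.

Fact win_is_word n (x : X) : is_word (win n x).
Proof. by apply/asboolP; exists x. Qed.

Definition prefix n (x : X) : word n := exist _ (win n x) (win_is_word n x).

Lemma prefixP n (x y : X) :
  prefix n x = prefix n y <-> (forall i, (i < n)%N -> coord x i = coord y i).
Proof.
by rewrite -winP; split=> [/(congr1 val)//|xy]; exact: val_inj.
Qed.

Lemma prefix_surj n (w : word n) : exists x : X, prefix n x = w.
Proof. by have /asboolP[x xw] := valP w; exists x; exact: val_inj. Qed.

Definition representative n (w : word n) : X := projT1 (cid (prefix_surj w)).

Lemma representativeK n : cancel (@representative n) (@prefix n).
Proof. by move=> w; rewrite /representative; case: cid. Qed.

Definition nwords n : nat := #|{: word n}|.

Lemma nwords_gt0 n : (0 < nwords n)%N.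
Proof. by apply/card_gt0P; exists (prefix n point). Qed.

Lemma nwords_le n : (nwords n <= m ^ n)%N.
Proof.
rewrite -[X in (_ <= X ^ _)%N]card_ord -[X in (_ <= _ ^ X)%N]card_ord -card_ffun.
exact: (leq_card _ val_inj).
Qed.

(** A word of length [n + k] is determined by its first [n] symbols and its last
    [k] symbols, and the latter form a word by shift invariance. *)
Lemma nwordsD n k : (nwords (n + k) <= nwords n * nwords k)%N.
Proof.
rewrite -card_prod.
apply: (leq_card (fun w : word (n + k) =>
  (prefix n (representative w),
   prefix k (iter n (subshift_map X) (representative w))))).
move=> w w' [] /winP h1 /winP h2.
rewrite -(representativeK w) -(representativeK w').
apply/prefixP => i lt; have [ltn|len] := ltnP i n; first exact: h1.
by have := h2 (i - n)%N; rewrite !coord_iter subnKC//; apply; rewrite ltn_subLR.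
Qed.

Definition log_nwords n : R := ln (nwords n)%:R.

Lemma nwordsR_gt0 n : 0 < (nwords n)%:R :> R.
Proof. by rewrite ltr0n nwords_gt0. Qed.

Lemma log_nwords_ge0 n : 0 <= log_nwords n.
Proof. by rewrite ln_ge0// ler1n nwords_gt0. Qed.

Lemma log_nwordsD n k : log_nwords (n + k)%N <= log_nwords n + log_nwords k.
Proof.
rewrite /log_nwords -lnM ?posrE ?nwordsR_gt0// ler_ln ?posrE ?mulr_gt0 ?nwordsR_gt0//.
by rewrite -natrM ler_nat nwordsD.
Qed.

Lemma covering_le n (eps : R) : diam_bound * beta ^- n <= eps ->
  Defs.covered_by X eps (nwords n).
Proof.
move=> le; exists (fun j => representative (enum_val j)) => x.
exists (enum_rank (prefix n x)); rewrite enum_rankK; apply: le_trans le.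
by apply: mdist_le_coord; apply/prefixP; rewrite representativeK.
Qed.

Lemma covering_ge n (eps : R) N : 2 * eps < beta ^- n ->
  Defs.covered_by X eps N -> (nwords n <= N)%N.
Proof.
move=> lt [c cP].
have [f fP] := choice (fun w : word n => cP (representative w)).
rewrite -[leqRHS]card_ord; apply: (leq_card f) => w w' ff.
rewrite -(representativeK w) -(representativeK w').
apply/prefixP => i lin; apply/eqP; apply: contraT => neq.
have := mdist_ge_coord (ltnW lin) neq; rewrite leNgt => /negP; case.
apply: le_lt_trans lt; apply: le_trans (metric_triangle _ (c (f w)) _) _.
have := fP w; have := fP w'; rewrite -ff (metric_sym (representative w)); lra.
Qed.

(** At scale [beta ^- n] the covering number lies between the numbers of words of
    lengths [n - s] and [n + s], with [s] independent of [n]; subadditivity absorbs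
    the shift by [s] into the constant. *)
Lemma covering_number_shell : exists (c : R) n0, forall n eps, (n0 <= n)%N ->
  beta ^- n.+1 < eps <= beta ^- n ->
  `|ln (covering_number X eps)%:R - log_nwords n| <= c + ln n%:R.
Proof.
have [s sP] := pow_unbounded (3 + diam_bound * beta).
have K0 : 0 <= diam_bound * beta by rewrite mulr_ge0 ?diam_bound_ge0 ?ltW.
exists (log_nwords s), s.+1 => n eps sn /andP[lo hi].
have [|cov up] := @nat_min_mem (Defs.covered_by X eps) (nwords (n + s)).
  apply: covering_le; apply: le_trans (ltW lo).
  have -> : diam_bound * beta ^- (n + s) =
      diam_bound * beta / beta ^+ s * beta ^- n.+1.
    by rewrite exprD exprS; field; rewrite !expf_neq0 ?gt_eqF.
  rewrite ler_piMl ?invr_ge0 ?exprn_ge0 ?(ltW beta_gt0)//.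
  by rewrite ler_pdivrMr ?exprn_gt0// mul1r; lra.
have down : (nwords (n - s) <= covering_number X eps)%N.
  apply: covering_ge cov; apply: le_lt_trans (_ : 2 * beta ^- n < _).
    by rewrite ler_pM2l.
  have -> : beta ^- (n - s) = beta ^+ s / beta ^+ n.
    rewrite -[in RHS](subnK (ltnW sn)) exprD; field.
    by rewrite !expf_neq0// gt_eqF.
  by rewrite ltr_pM2r ?invr_gt0 ?exprn_gt0//; lra.
have N0 : (0 < covering_number X eps)%N by exact: leq_trans (nwords_gt0 _) down.
have ln0 : 0 <= ln (n%:R : R).
  by rewrite ln_ge0// ler1n (leq_ltn_trans _ sn).
have := log_nwordsD n s; have := log_nwordsD (n - s) s; rewrite subnK ?(ltnW sn)//.
have : log_nwords (n - s) <= ln (covering_number X eps)%:R.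
  by rewrite ler_ln ?posrE ?nwordsR_gt0 ?ltr0n// ler_nat.
have : ln (covering_number X eps)%:R <= log_nwords (n + s).
  by rewrite ler_ln ?posrE ?nwordsR_gt0 ?ltr0n// ler_nat.
rewrite ler_norml; lra.
Qed.

End subshift_words.

Arguments diam_bound {R} m beta.
Arguments diam_bound_ge0 {R} m {beta} beta_gt1.

(** * Finitely supported measures and bounds on Wasserstein distances *)

Section finitely_supported.
Context {d : measure_display} {T : measurableType d} {R : realType} {I : finType}.
Variables (p : I -> R) (z : I -> T) (i0 : I).
Hypotheses (p_ge0 : forall i, 0 <= p i) (p_sum1 : \sum_i p i = 1).

Let pt (k : nat) : I := nth i0 (enum I) k.

Let sum_pt (V : nmodType) (F : I -> V) : \sum_(k < #|I|) F (pt k) = \sum_i F i.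
Proof.
transitivity (\sum_(i <- enum I) F i); last by rewrite big_enum.
by rewrite (big_nth i0) -cardE big_mkord.
Qed.

Definition weighted_diracs : set T -> \bar R :=
  msum (fun k => mscale (NngNum (p_ge0 (pt k))) (dirac (z (pt k)))) #|I|.

HB.instance Definition _ := Measure.on weighted_diracs.

Lemma weighted_diracsE (A : set T) :
  weighted_diracs A = (\sum_i p i * \1_A (z i))%:E.
Proof.
rewrite -(sum_pt (fun i => p i * \1_A (z i))) -sumEFin.
by apply: eq_bigr => k _; rewrite EFinM.
Qed.

Fact weighted_diracs_setT : weighted_diracs setT = 1%E.
Proof.
rewrite weighted_diracsE -p_sum1; congr _%:E.
by apply: eq_bigr => i _; rewrite indicT mulr1.
Qed.

HB.instance Definition _ :=
  Measure_isProbability.Build _ _ _ weighted_diracs weighted_diracs_setT.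

Lemma integral_weighted_diracs (f : T -> R) :
  measurable_fun setT f -> (forall x, 0 <= f x) ->
  (\int[weighted_diracs]_x (f x)%:E = (\sum_i p i * f (z i))%:E)%E.
Proof.
move=> mf f0; rewrite -(sum_pt (fun i => p i * f (z i))) -sumEFin.
have mEf : measurable_fun setT (EFin \o f) by exact/measurable_EFinP.
rewrite ge0_integral_measure_sum//; last by move=> x _; rewrite lee_fin.
apply: eq_bigr => k _; rewrite ge0_integral_mscale//=; last first.
  by move=> x _; rewrite lee_fin.
by rewrite integral_dirac// diracT mul1e.
Qed.

Lemma finitely_supported_probability : exists mu : probability T R,
  (forall A, mu A = (\sum_i p i * \1_A (z i))%:E) /\
  (forall f : T -> R, measurable_fun setT f -> (forall x, 0 <= f x) ->
     (\int[mu]_x (f x)%:E = (\sum_i p i * f (z i))%:E)%E).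
Proof.
exists weighted_diracs; split=> [A|f]; first exact: weighted_diracsE.
exact: integral_weighted_diracs.
Qed.

End finitely_supported.

Section subshift_measure.
Context {R : realType} {m : nat} {beta : R} {beta_gt1 : 1 < beta}.
Variable X : subshift m beta_gt1.
Local Notation f := (subshift_map X).

Let beta_gt0 : 0 < beta. Proof. exact: lt_trans beta_gt1. Qed.

(** Points closer than [beta ^- n] share their first [n] symbols. *)
Lemma open_local n (A : set X) :
  (forall x y : X, (forall i, (i < n)%N -> coord x i = coord y i) -> A x -> A y) ->
  open A.
Proof.
move=> locA; rewrite openE => x Ax.
apply/nbhs_ballP; exists (beta ^- n) => /=; first by rewrite invr_gt0 exprn_gt0.
rewrite ballEmdist => y /= xy; apply: locA Ax => i lin; apply/eqP.
by apply: contraTT xy => neq; rewrite -leNgt (mdist_ge_coord (ltnW lin)) ?neq.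
Qed.

Lemma measurable_local n (A : set X) :
  (forall x y : X, (forall i, (i < n)%N -> coord x i = coord y i) -> A x -> A y) ->
  measurable (A : set (borel X)).
Proof. by move=> /open_local oA; exact: sub_sigma_algebra. Qed.

Lemma measurable_coord j : measurable_fun setT (fun x : borel X => (coord x j)%:R : R).
Proof.
move=> _ B _; rewrite setTI; apply: (@measurable_local j.+1) => x y xy.
by rewrite /preimage/= xy.
Qed.

Lemma measurable_mdist :
  measurable_fun setT (fun z : borel X * borel X => mdist (z.1 : X) (z.2 : X)).
Proof.
apply: (@measurable_fun_cvg _ (borel X * borel X)%type R setT
  (fun N z => series (dist_term (set_val (z.1 : X)) (set_val (z.2 : X))) N)
  (fun z => mdist (z.1 : X) (z.2 : X))); last first.
  by move=> z _; exact: dist_term_cvg.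
move=> N; apply: measurable_sum => j; apply: measurable_funM => //.
apply: measurableT_comp => //; apply: measurable_funB.
  exact: (measurableT_comp (measurable_coord j) measurable_fst).
exact: (measurableT_comp (measurable_coord j) measurable_snd).
Qed.

(** The easy half of Kantorovich duality for the test function [dl] times the
    indicator of [A]: every coupling moves a mass of at least [mu A - nu A] out of
    [A], and over a distance of at least [dl]. *)
Lemma W1_ge_separated (A : set (borel X)) (dl : R) (mu nu : probability (borel X) R) :
  measurable A -> 0 <= dl ->
  (forall x y : X, A x -> ~ A y -> dl <= mdist x y) ->
  (dl%:E * (mu A - nu A) <= W1 mu nu)%E.
Proof.
move=> mA dl0 sep; apply: le_ereal_inf_tmp => _ [pi piP <-].
have mAC : measurable (A `*` ~` A) by apply: measurableX => //; exact: measurableC.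
apply: (@le_trans _ _ (\int[pi]_z (dl%:E * (\1_(A `*` ~` A) z)%:E))%E).
  have mI : measurable_fun setT (EFin \o (\1_(A `*` ~` A) : borel X * borel X -> R)).
    by apply/measurable_EFinP; exact: measurable_indic.
  rewrite ge0_integralZl_EFin//.
  rewrite integral_indic// setIT lee_wpmul2l ?lee_fin//.
  rewrite leeBlDr ?fin_num_measure//.
  have [<- <-] := piP _ mA.
  have -> : A `*` setT = (A `*` ~` A) `|` (A `*` A).
    by apply/seteqP; split=> -[x y]; have := EM (A y); rewrite /setX/=; tauto.
  apply: le_trans (measureU2 _ _ _) _ => //; first exact: measurableX.
  rewrite leeD2l// le_measure// ?inE; [exact: measurableX|exact: measurableX|].
  by move=> [x y] [].
apply: ge0_le_integral => //.
- by move=> z _; rewrite -EFinM lee_fin mulr_ge0.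
- apply/measurable_EFinP; apply: measurable_funM => //; exact: measurable_indic.
- by apply/measurable_EFinP; exact: measurable_mdist.
- move=> [x y] _; rewrite -EFinM lee_fin indicE.
  have [|_] := boolP (_ \in _); last by rewrite mulr0 mdist_ge0.
  by rewrite inE mulr1 => -[/= Ax Ay]; exact: sep.
Qed.

Lemma empiricalE k (x : X) (A : set (borel X)) :
  empirical f k x A = (k.+1%:R^-1 * \sum_(j < k.+1) \1_A (iter j f x : borel X))%:E.
Proof. by rewrite EFinM -sumEFin. Qed.

End subshift_measure.

(** * Upper bound: quantizing the empirical measures *)

Section quantization.
Context {R : realType} {m : nat} {beta : R} {beta_gt1 : 1 < beta}.
Variable X : subshift m beta_gt1.
Local Notation f := (subshift_map X).

Definition word_freq n k (x : X) (w : word X n) : R :=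
  k.+1%:R^-1 * \sum_(j < k.+1) (prefix n (iter j f x) == w)%:R.

Lemma word_freq_ge0 n k (x : X) (w : word X n) : 0 <= word_freq k x w.
Proof. by rewrite mulr_ge0// sumr_ge0. Qed.

Lemma average_prefix n k (x : X) (g : word X n -> R) :
  k.+1%:R^-1 * \sum_(j < k.+1) g (prefix n (iter j f x)) =
  \sum_w word_freq k x w * g w.
Proof.
rewrite /word_freq; under [RHS]eq_bigr => w _ do rewrite -mulrA mulr_suml.
rewrite -mulr_sumr exchange_big/=; congr (_ * _); apply: eq_bigr => j _.
rewrite (bigD1 (prefix n (iter j f x)))//= eqxx mul1r big1 ?addr0// => w.
by rewrite eq_sym => /negbTE->; rewrite mul0r.
Qed.

Lemma sum_word_freq n k (x : X) : \sum_(w : word X n) word_freq k x w = 1.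
Proof.
have := average_prefix k x (fun _ : word X n => 1).
rewrite sumr_const card_ord mulVf ?pnatr_eq0// => ->.
by apply: eq_bigr => w _; rewrite mulr1.
Qed.

Lemma word_freq_gt0 n k (x : X) (j : 'I_k.+1) :
  0 < word_freq k x (prefix n (iter j f x)).
Proof.
rewrite mulr_gt0// ?invr_gt0 ?ltr0n// (bigD1 j)//= eqxx ltr_wpDr// sumr_ge0//.
Qed.

(** The target puts mass [a w] at the representative of each word [w] and the
    rest at [c0].  A measure whose word frequencies dominate [a] is carried to it
    by sending, from each point with prefix [w], the share [a w / frequency of w]
    to the representative of [w], at cost at most [C * beta ^- n] per unit of mass,
    and the complementary share to [c0], at cost at most [C].  The target does not
    depend on the empirical measure, only on the lower bounds [a]. *)
Lemma W1_quantized n (x c0 : X) (a : word X n -> R) : (forall w, 0 <= a w) -> \sum_w a w <= 1 ->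
  exists mu : probability (borel X) R, forall k,
    (forall w, a w <= word_freq k x w) ->
    (W1 (empirical f k x) mu <=
      (diam_bound m beta * (beta ^- n + (1 - \sum_w a w)))%:E)%E.
Proof.
move=> a0 a1.
pose p (w : option (word X n)) := if w is Some w then a w else 1 - \sum_w a w.
pose z (w : option (word X n)) : borel X :=
  if w is Some w then representative w else c0.
have p0 w : 0 <= p w by case: w => [w|] /=; rewrite ?subr_ge0.
have big_opt (F : option (word X n) -> R) :
    \sum_w F w = F None + \sum_w F (Some w).
  rewrite (bigD1 None)//=; congr (_ + _).
  rewrite (reindex_omap Some id) => [|[w|]//].
  by apply: eq_bigl => w; rewrite eqxx.
have p1 : \sum_w p w = 1 by rewrite big_opt/= subrK.
have [mu [muE _]] := finitely_supported_probability z None p0 p1.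
exists mu => k ak.
pose rho (w : word X n) : R := a w / word_freq k x w.
have rho0 w : 0 <= rho w by rewrite divr_ge0// word_freq_ge0.
(* Also true for a word of frequency 0, since then [a w = 0]. *)
have rhoE w : word_freq k x w * rho w = a w.
  have [q0|q0] := eqVneq (word_freq k x w) 0; last by rewrite mulrC divfK.
  by rewrite q0 mul0r; apply/eqP; rewrite eq_le a0 -q0 ak.
have rho1 (j : 'I_k.+1) : rho (prefix n (iter j f x)) <= 1.
  by rewrite ler_pdivrMr ?word_freq_gt0// mul1r.
(* The atom [(j, true)] of the coupling moves the [j]-th orbit point to the
   representative of its prefix, the atom [(j, false)] moves it to [c0]. *)
pose pp (i : 'I_k.+1 * bool) : R := k.+1%:R^-1 *
  (if i.2 then rho (prefix n (iter i.1 f x))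
   else 1 - rho (prefix n (iter i.1 f x))).
pose zz (i : 'I_k.+1 * bool) : borel X * borel X :=
  (iter i.1 f x, if i.2 then representative (prefix n (iter i.1 f x)) else c0).
have sum_pp (F : borel X * borel X -> R) : \sum_i pp i * F (zz i) =
    k.+1%:R^-1 * \sum_(j < k.+1)
      (rho (prefix n (iter j f x)) *
         F (iter j f x : X, representative (prefix n (iter j f x)))
       + (1 - rho (prefix n (iter j f x))) * F (iter j f x : X, c0)).
  rewrite -(pair_bigA _ (fun j b => pp (j, b) * F (zz (j, b))))/= mulr_sumr.
  by apply: eq_bigr => j _; rewrite big_bool /pp /zz/=; ring.
have pp0 i : 0 <= pp i.
  by rewrite mulr_ge0//; case: (i.2); rewrite ?subr_ge0.
have pp1 : \sum_i pp i = 1.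
  have := sum_pp (fun=> 1).
  under eq_bigr do rewrite mulr1; move=> ->.
  under eq_bigr do rewrite !mulr1 subrKC.
  by rewrite sumr_const card_ord mulVf ?pnatr_eq0.
have [pi [piE piI]] := finitely_supported_probability zz (ord0, true) pp0 pp1.
have coup : coupling (empirical f k x) mu pi.
  move=> A mA; split.
    rewrite piE; apply: etrans (esym (empiricalE k x A)).
    rewrite (sum_pp (\1_(A `*` setT))); congr (_ * _)%:E.
    apply: eq_bigr => j _; rewrite !indicE !in_setX !in_setT !andbT.
    by rewrite -mulrDl subrKC mul1r.
  rewrite piE muE (sum_pp (\1_(setT `*` A))) big_opt/=; congr _%:E.
  pose g w := rho w * \1_A (representative w : borel X)
    + (1 - rho w) * \1_A (c0 : borel X).
  transitivity (k.+1%:R^-1 * \sum_(j < k.+1) g (prefix n (iter j f x))).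
    congr (_ * _); apply: eq_bigr => j _.
    by rewrite /g !indicE !in_setX !in_setT.
  rewrite average_prefix [RHS]addrC.
  rewrite -(sum_word_freq n k x) -sumrB mulr_suml -big_split/=.
  by apply: eq_bigr => w _; rewrite -(rhoE w) /g; ring.
apply: le_trans (ereal_inf_le _) _.
  exists (\int[pi]_z (mdist (z.1 : X) (z.2 : X))%:E)%E; first by exists pi.
  exact: lexx.
rewrite piI; last 2 first.
- exact: measurable_mdist.
- by move=> ?; exact: mdist_ge0.
rewrite lee_fin (sum_pp (fun z => mdist (z.1 : X) (z.2 : X)))/=.
have C0 := diam_bound_ge0 m beta_gt1.
apply: (@le_trans _ _ (k.+1%:R^-1 * \sum_(j < k.+1)
   (diam_bound m beta * (beta ^- n + (1 - rho (prefix n (iter j f x))))))).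
  rewrite ler_wpM2l// ler_sum// => j _.
  set y := iter j f x.
  have d1 : mdist y (representative (prefix n y)) <= diam_bound m beta * beta ^- n.
    by apply: mdist_le_coord; apply/prefixP; rewrite representativeK.
  have d2 : mdist y c0 <= diam_bound m beta.
    by have := @mdist_le_coord _ _ _ _ X y c0 0; rewrite expr0 invr1 mulr1; exact.
  rewrite mulrDr lerD//.
    apply: le_trans d1; rewrite ler_piMl ?mdist_ge0//; exact: rho1.
  by rewrite mulrC ler_wpM2r// subr_ge0; exact: rho1.
rewrite (average_prefix k x (fun w => diam_bound m beta * (beta ^- n + (1 - rho w)))).
rewrite -[X in beta ^- n + (X - _)](sum_word_freq n k x) -sumrB.
rewrite -[X in diam_bound m beta * (X + _)]mul1r -[X in X * beta ^- n](sum_word_freq n k x).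
rewrite mulr_suml -big_split/= mulr_sumr ler_sum// => w _.
by rewrite -(rhoE w) mulrCA ler_wpM2l//; lra.
Qed.

(** Rounding the word frequencies down to multiples of [1 / Q] leaves at most
    [Q.+1 ^ nwords X n] possibilities, and the empirical measures with the same
    rounding are all close to one measure. *)
Lemma emergence_bound_count n Q (x : X) (eps : R) : (0 < Q)%N ->
  diam_bound m beta * (beta ^- n + (nwords X n)%:R / Q%:R) <= eps ->
  emergence_bound f x eps (Q.+1 ^ nwords X n)%N.
Proof.
move=> Q0 small; split; first by rewrite expn_gt0.
have Q0R : 0 < Q%:R :> R by rewrite ltr0n.
pose rounded k : {ffun word X n -> 'I_Q.+1} :=
  [ffun w => inord (Num.truncn (Q%:R * word_freq k x w))].
have roundedE k w : (rounded k w)%:R / Q%:R <= word_freq k x w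
    /\ word_freq k x w - (rounded k w)%:R / Q%:R <= Q%:R^-1.
  have q0 := word_freq_ge0 k x w.
  have q1 : word_freq k x w <= 1.
    rewrite -(sum_word_freq n k x) (bigD1 w)//= lerDl sumr_ge0// => *.
    exact: word_freq_ge0.
  have Qq0 : 0 <= Q%:R * word_freq k x w by rewrite mulr_ge0// ltW.
  have /andP[lo hi] := truncn_itv Qq0.
  have le : (Num.truncn (Q%:R * word_freq k x w) < Q.+1)%N.
    by rewrite ltnS -(ler_nat R) (le_trans lo)// ler_piMr// ltW.
  rewrite ffunE inordK//; split; first by rewrite ler_pdivrMr// [leRHS]mulrC.
  rewrite lerBlDr -[X in X + _]mul1r -mulrDl addrC natr1 ler_pdivlMr// [leLHS]mulrC; exact: ltW.
have ex (h : {ffun word X n -> 'I_Q.+1}) :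
    exists mu : probability (borel X) R, forall k, rounded k = h ->
      (W1 (empirical f k x) mu <= eps%:E)%E.
  have [[k0 k0h]|none] := pselect (exists k, rounded k = h); last first.
    by exists (empirical f 0 x) => k kh; case: none; exists k.
  have [||mu muP] := @W1_quantized n x x (fun w => (h w)%:R / Q%:R).
  - by move=> w; rewrite divr_ge0.
  - rewrite -[leRHS](sum_word_freq n k0 x) ler_sum// => w _; rewrite -k0h.
    exact: (proj1 (roundedE _ _)).
  exists mu => k kh; apply: le_trans (muP k _) _.
    by move=> w; rewrite -kh; exact: (proj1 (roundedE _ _)).
  rewrite lee_fin; apply: le_trans small.
  rewrite ler_wpM2l ?(diam_bound_ge0 m beta_gt1)// lerD2l.
  rewrite -[X in X - _](sum_word_freq n k x) -sumrB /nwords mulr_natl -sumr_const ler_sum// => w _.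
  by rewrite -kh; exact: (proj2 (roundedE _ _)).
have [M MP] := choice ex.
have card : #|{: {ffun word X n -> 'I_Q.+1}}| = (Q.+1 ^ nwords X n)%N.
  by rewrite card_ffun card_ord.
rewrite -card; exists (fun i => M (enum_val i)).
apply: ereal_inf_le.
exists (ereal_sup [set (\big[mine/+oo]_(j < #|{: {ffun word X n -> 'I_Q.+1}}|)
   W1 (empirical f k x) (M (enum_val j)))%E | k in setT]).
  by exists setT => //; exact: filterT.
apply: ge_ereal_sup => _ [k _ <-].
apply: le_trans (bigmin_le _ (enum_rank (rounded k)) _) _.
by rewrite enum_rankK; exact: MP.
Qed.

End quantization.

(** * Double exponential growth: upper bound *)

Section upper_growth.
Context {R : realType} {m : nat} {beta : R} {beta_gt1 : 1 < beta}.
Variable X : subshift m beta_gt1.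
Local Notation f := (subshift_map X).

Let beta_gt0 : 0 < beta. Proof. exact: lt_trans beta_gt1. Qed.

(** Quantize with words of length [n + s] and with [Q] a power [b ^ (n + s + 2)].
    Then [ln Q.+1] is only linear in [n], so the double logarithm of
    [Q.+1 ^ nwords X (n + s)] is [log_nwords X n] up to [O(ln n)]. *)
Lemma emergence_upper_shell : exists c : R, forall n eps (x : X), (0 < n)%N ->
  beta ^- n.+1 < eps ->
  emergence_bound f x eps (emergence f x eps) /\
  ln (ln (emergence f x eps)%:R) <= log_nwords X n + (c + ln n%:R).
Proof.
pose C := diam_bound m beta; have C0 : 0 <= C := diam_bound_ge0 m beta_gt1.
have [s sP] := @pow_unbounded _ _ beta_gt1 (2 * (C * beta)).
have mb0 : 0 <= m%:R * beta by rewrite mulr_ge0 ?(ltW beta_gt0).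
pose b := (Num.truncn (m%:R * beta + 2 * C)).+1.
have bP : m%:R * beta + 2 * C <= b%:R by exact/ltW/truncnS_gt.
have m1 : 1 <= m%:R :> R.
  by rewrite ler1n (leq_ltn_trans (leq0n _) (ltn_ord (coord (point : X) 0))).
have bbeta : beta <= b%:R.
  have : beta <= m%:R * beta by rewrite ler_peMl// ltW.
  by lra.
have b2 : (2 <= b)%N by rewrite -(ltr_nat R); exact: lt_le_trans beta_gt1 bbeta.
have b0N : (0 < b)%N by rewrite /b.
have b0 : 0 < b%:R :> R by rewrite ltr0n.
pose K : nat := ((s + 4) * b)%N.
have K0 : (0 < K)%N by rewrite /K muln_gt0 addn_gt0 orbT.
exists (log_nwords X s + ln K%:R) => n eps x n0 lo.
pose Q := (b ^ (n + s + 2))%N.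
have Q0 : (0 < Q)%N by rewrite expn_gt0.
(* [b] dominates [m * beta], [beta] and [2 * C]: with [N = n + s], the left-hand
   side is at most [m ^ N * beta ^ N * beta * (2 * C)]. *)
have wQ : (nwords X (n + s))%:R * (2 * C) * beta ^+ n.+1 <= Q%:R.
  have W_le : (nwords X (n + s))%:R <= m%:R ^+ (n + s) :> R.
    by rewrite -natrX ler_nat nwords_le.
  have beta_le : beta ^+ n.+1 <= beta ^+ (n + s) * b%:R.
    apply: (@le_trans _ _ (beta ^+ (n + s) * beta)).
      by rewrite -exprSr ler_weXn2l ?(ltW beta_gt1)// ltnS leq_addr.
    by rewrite ler_wpM2l// exprn_ge0// ltW.
  have mbeta_le : (m%:R * beta) ^+ (n + s) <= b%:R ^+ (n + s).
    by rewrite lerXn2r ?nnegrE// ?(ltW b0)//; lra.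
  have C_le : 2 * C <= b%:R by lra.
  apply: (@le_trans _ _ (m%:R ^+ (n + s) * b%:R * (beta ^+ (n + s) * b%:R))).
    have C20 : 0 <= 2 * C by rewrite mulr_ge0.
    apply: ler_pM => //; [exact: mulr_ge0|by rewrite exprn_ge0// ltW|].
    exact: ler_pM.
  rewrite mulrACA -exprMn /Q natrX (exprD _ (n + s) 2) expr2 ler_wpM2r//.
have small : C * (beta ^- (n + s) + (nwords X (n + s))%:R / Q%:R) <= eps.
  apply: le_trans (ltW lo); rewrite mulrDr.
  have h1 : C * beta ^- (n + s) <= beta ^- n.+1 / 2.
    have -> : C * beta ^- (n + s) = 2 * (C * beta) / beta ^+ s * (beta ^- n.+1 / 2).
      by rewrite exprD exprS; field; rewrite !expf_neq0 ?gt_eqF.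
    rewrite ler_piMl ?divr_ge0 ?invr_ge0 ?exprn_ge0 ?(ltW beta_gt0)//.
    by rewrite ler_pdivrMr ?exprn_gt0// mul1r.
  have h2 : C * ((nwords X (n + s))%:R / Q%:R) <= beta ^- n.+1 / 2.
    have Q0R : 0 < Q%:R :> R by rewrite ltr0n.
    rewrite mulrA ler_pdivrMr//.
    have -> : beta ^- n.+1 / 2 * Q%:R = Q%:R / 2 / beta ^+ n.+1 by ring.
    by rewrite ler_pdivlMr ?exprn_gt0//; lra.
  lra.
have [Eb Ele] := nat_min_mem (emergence_bound_count x Q0 small).
split=> //; rewrite -/(emergence f x eps) in Eb Ele *.
have E0 : (0 < emergence f x eps)%N by case: Eb.
have nR : 1 <= n%:R :> R by rewrite ler1n.
have W1R : 1 <= (nwords X (n + s))%:R :> R by rewrite ler1n nwords_gt0.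
have lnQ : ln Q.+1%:R <= K%:R * n%:R :> R.
  apply: (@le_trans _ _ (ln (b%:R ^+ (n + s + 3)))).
    rewrite ler_ln ?posrE ?ltr0n ?exprn_gt0// -natrX ler_nat /Q.
    have -> : (n + s + 3 = (n + s + 2).+1)%N by rewrite addn3 addn2.
    rewrite expnS; apply: (@leq_trans (2 * b ^ (n + s + 2))).
      by rewrite mul2n -addnn -addn1 leq_add2l.
    by rewrite leq_mul2r b2 orbT.
  rewrite lnXn// -[leLHS]mulr_natl.
  have lnb : ln (b%:R : R) <= b%:R by exact/ltW/ln_sublinear.
  apply: (@le_trans _ _ ((n + s + 3)%:R * b%:R)); first by rewrite ler_wpM2l.
  rewrite -!natrM ler_nat /K mulnAC leq_mul2r; apply/orP; right.
  by rewrite -addnA [(s + 4)%N]addnS mulSn leq_add2l leq_pmulr.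
pose B : R := (nwords X (n + s))%:R * (K%:R * n%:R).
have KR : 1 <= K%:R :> R by rewrite ler1n.
have B1 : 1 <= B by rewrite !mulr_ege1.
have lnE : ln (emergence f x eps)%:R <= B.
  apply: (@le_trans _ _ (ln (Q.+1 ^ nwords X (n + s))%:R)).
    by rewrite ler_ln ?posrE ?ltr0n ?expn_gt0// ler_nat.
  by rewrite natrX lnXn ?ltr0n// -[leLHS]mulr_natl ler_wpM2l.
have lnB : ln B <= log_nwords X n + (log_nwords X s + ln K%:R + ln n%:R).
  have := log_nwordsD X n s; rewrite /B !lnM ?posrE ?mulr_gt0 ?nwordsR_gt0 ?ltr0n//.
  by rewrite -/(log_nwords X (n + s)); lra.
apply: le_trans lnB.
have [le|gt] := leP (ln (emergence f x eps)%:R) (0 : R).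
  by rewrite (@le_trans _ _ 0)// ?ln_ge0// ln_le0// (le_trans le).
by rewrite ler_ln// posrE// (lt_le_trans _ B1).
Qed.

End upper_growth.

(** * Periodic orbits given by specification *)

Section periodic_orbits.
Context {R : realType} {m : nat} {beta : R} {beta_gt1 : 1 < beta}.
Variable X : subshift m beta_gt1.
Local Notation f := (subshift_map X).

(** Specification at scale 1 with gaps of constant length: points at distance less
    than 1 have the same symbol at index 0, so shadowing during a block is equality
    of symbols on that block.  The [k]-th block starts at [N k]. *)
Definition gap_shadowing (t : nat) : Prop :=
  forall (K : nat) (p : 'I_K -> X) (n : nat -> nat), (0 < K)%N ->
  (forall k, 0 < n k)%N ->
  let N k := (\sum_(j < k) (n j + t))%N in
  exists x : X, iter (N K) f x = x /\
    forall (k : 'I_K) i, (N k <= i < N k + n k)%N -> coord x i = coord (p k) i.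

Lemma specification_gap : specification f -> exists t, gap_shadowing t.
Proof.
move=> /(_ 1 ltr01)[tau tau0 spec]; exists (Num.truncn tau).+1.
set t := _.+1 => K p n K0 n0 N.
have [||||x [xN xp]] := spec K p (fun k => n k) (fun k => n k + t)%N.
- exact: K0.
- by move=> k; exact: n0.
- by move=> k; rewrite addn_gt0 n0.
- move=> k; rewrite natrD addrAC subrr add0r; exact/ltW/truncnS_gt.
have NE k : (k <= K)%N -> (\sum_(j < K | (j < k)%N) (n j + t))%N = N k.
  by move=> kK; rewrite /N (big_ord_widen K (fun j => n j + t)%N).
exists x; split; first by rewrite -NE.
move=> k i; rewrite -(NE k (ltnW (ltn_ord k))) => ki.
have := xp k i ki; rewrite ballEmdist/= => lt1.
rewrite -[i]addn0 -!coord_iter; apply/esym/eqP; apply: contraTT lt1 => neq.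
rewrite -leNgt.
by have := @mdist_ge_coord _ _ _ _ X _ _ 0 0 (leqnn _) neq; rewrite expr0 invr1.
Qed.

Definition periodic P (y : X) : Prop := iter P f y = y.

Lemma periodic_mod P (y : X) j : periodic P y -> iter (j %% P) f y = iter j f y.
Proof.
move=> yP; rewrite {2}(divn_eq j P) addnC iterD; congr (iter _ _ _).
by elim: (j %/ P)%N => //= q IH; rewrite mulSn iterD -IH.
Qed.

Lemma periodic_iter P (y : X) j : periodic P y -> periodic P (iter j f y).
Proof. by move=> yP; rewrite /periodic -iterD addnC iterD yP. Qed.

Definition orbit_windows P (y : X) : {set {ffun 'I_P -> 'I_m}} :=
  [set win P (iter j f y) | j : 'I_P]%SET.

Lemma card_orbit_windows P (y : X) : (#|orbit_windows P y| <= P)%N.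
Proof. by rewrite (leq_trans (leq_imset_card _ _))// card_ord. Qed.

Lemma mem_orbit_windows P (y : X) j : (0 < P)%N -> periodic P y ->
  win P (iter j f y) \in orbit_windows P y.
Proof.
move=> P0 yP; rewrite -(periodic_mod j yP).
by apply/imsetP; exists (Ordinal (ltn_pmod j P0)).
Qed.

Lemma periodic_win_inj P (y z : X) : (0 < P)%N -> periodic P y -> periodic P z ->
  win P y = win P z -> y = z.
Proof.
move=> P0 yP zP /winP yz; apply: coord_inj => i.
rewrite -[i]addn0 -!coord_iter -(periodic_mod i yP) -(periodic_mod i zP).
by rewrite !coord_iter addn0 yz// ltn_pmod.
Qed.

(** A point of period [P] is determined by its window of length [P], so two orbits
    with a common window coincide. *)
Lemma orbit_windows_eq P (y z : X) w : (0 < P)%N -> periodic P y -> periodic P z ->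
  w \in orbit_windows P y -> w \in orbit_windows P z ->
  orbit_windows P y = orbit_windows P z.
Proof.
move=> P0.
suff sub (y' z' : X) : periodic P y' -> periodic P z' ->
    w \in orbit_windows P y' -> w \in orbit_windows P z' ->
    orbit_windows P y' \subset orbit_windows P z'.
  by move=> yP zP wy wz; apply/eqP; rewrite finset.eqEsubset !sub.
move=> yP zP /imsetP[j _ ->] /imsetP[j' _ /periodic_win_inj eq].
have {}eq : iter j f y' = iter j' f z' by apply: eq => //; exact: periodic_iter.
have -> : y' = iter (P - j + j') f z'.
  by rewrite iterD -eq -iterD subnK ?(ltnW (ltn_ord j)).
apply/fintype.subsetP => _ /imsetP[i _ ->].
by rewrite -iterD; exact: mem_orbit_windows.
Qed.

Definition orbits P : {set {set {ffun 'I_P -> 'I_m}}} :=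
  [set O : {set {ffun 'I_P -> 'I_m}} |
    `[< exists y, periodic P y /\ O = orbit_windows P y >]]%SET.

Lemma orbitsP P (O : {set {ffun 'I_P -> 'I_m}}) :
  O \in orbits P <-> exists y, periodic P y /\ O = orbit_windows P y.
Proof. by rewrite finset.in_set; split=> /asboolP. Qed.

Lemma orbits_disjoint P (O O' : {set {ffun 'I_P -> 'I_m}}) w : (0 < P)%N ->
  O \in orbits P -> O' \in orbits P -> w \in O -> w \in O' -> O = O'.
Proof.
move=> P0 /orbitsP[y [yP ->]] /orbitsP[z [zP ->]].
exact: orbit_windows_eq.
Qed.

(** Every word of length [n] begins a point of period [n + t], and an orbit of
    period [n + t] has at most [n + t] windows. *)
Lemma nwords_le_orbits n t : (0 < n)%N -> gap_shadowing t ->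
  (nwords X n <= #|orbits (n + t)| * (n + t))%N.
Proof.
move=> n0 spec; set P := (n + t)%N.
have P0 : (0 < P)%N by rewrite addn_gt0 n0.
have per (w : word X n) : exists y, periodic P y /\ prefix n y = w.
  have [|y] := spec 1%N (fun=> representative w) (fun=> n) isT.
    by [].
  rewrite big_ord_recl big_ord0 addn0 => -[yP yw]; exists y; split=> //.
  rewrite -[RHS]representativeK; apply/prefixP => i lin.
  by apply: (yw ord0); rewrite big_ord0.
have [Y YP] := choice per.
apply: (@leq_trans #|finset.cover (orbits P)|).
  have inj : injective (fun w => win P (Y w)).
    move=> w w' /winP eq; rewrite -(proj2 (YP w)) -(proj2 (YP w')).
    by apply/prefixP => i lin; apply: eq; rewrite ltn_addr.
  rewrite /nwords -(card_codom inj); apply: subset_leq_card.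
  apply/fintype.subsetP => _ /codomP[w ->].
  apply/bigcupP; exists (orbit_windows P (Y w)).
    by apply/orbitsP; exists (Y w); split=> //; exact: proj1 (YP w).
  by rewrite -[Y w]/(iter 0 f (Y w)) mem_orbit_windows//; exact: proj1 (YP w).
apply: leq_trans (leq_card_cover _) _; rewrite -sum_nat_const leq_sum// => O.
by move=> /orbitsP[y [_ ->]]; exact: card_orbit_windows.
Qed.

Definition visits P k (x : X) (O : {set {ffun 'I_P -> 'I_m}}) : nat :=
  (\sum_(j < k) (win P (iter j f x) \in O))%N.

(** The [P] last windows of the block may leave it. *)
Lemma visits_block P k (x y : X) N T : (0 < P)%N -> periodic P y ->
  (N + T <= k)%N ->
  (forall i, (N <= i < N + T)%N -> coord x i = coord y i) ->
  (T - P <= visits k x (orbit_windows P y))%N.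
Proof.
move=> P0 yP NTk xy; rewrite /visits.
rewrite -(big_mkord xpredT (fun j => (win P (iter j f x) \in orbit_windows P y) : nat)).
have NTP : (N + (T - P) <= k)%N by rewrite (leq_trans _ NTk)// leq_add2l leq_subr.
rewrite (big_cat_nat (leq0n N)) ?(leq_trans (leq_addr _ _) NTk)//=.
rewrite [X in (_ + X)%N](big_cat_nat (leq_addr (T - P) N))//=.
rewrite addnCA (leq_trans _ (leq_addr _ _))//.
rewrite big_nat (eq_bigr (fun=> 1%N)) => [|j /andP[Nj jT]].
  by rewrite -big_nat sum_nat_const_nat muln1 addKn.
have -> : win P (iter j f x) = win P (iter j f y).
  apply/winP => i iP; rewrite !coord_iter; apply: xy.
  by rewrite (leq_trans Nj) ?leq_addr//=; move: jT iP; lia.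
by rewrite mem_orbit_windows.
Qed.

(** The shadowing point follows [x] during [a] steps, and then the periodic orbits
    one after the other during [T] steps each. *)
Lemma shadow_orbits t P (x : X) (a T r : nat) (y : nat -> X) :
  gap_shadowing t -> (0 < P)%N -> (0 < a)%N -> (0 < T)%N ->
  (forall i, (i < r)%N -> periodic P (y i)) ->
  exists z : X, (forall i, (i < a)%N -> coord z i = coord x i) /\
    forall i, (i < r)%N ->
      (T - P <= visits (a + t + r * (T + t)) z (orbit_windows P (y i)))%N.
Proof.
move=> spec P0 a0 T0 yP.
pose n k := if k is 0%N then a else T.
pose p (k : 'I_r.+1) := if (k : nat) is i.+1 then y i else x.
have [|z [_ zP]] := spec r.+1 p n isT; first by case.
have NS k : (\sum_(j < k.+1) (n j + t) = a + t + k * (T + t))%N.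
  by rewrite big_ord_recl/= sum_nat_const card_ord.
exists z; split=> [i ia|i ir].
  by apply: (zP ord0); rewrite big_ord0.
apply: (@visits_block _ _ _ _ (a + t + i * (T + t)) T) => //; first exact: yP.
  rewrite -addnA leq_add2l (leq_trans (n := (i.+1 * (T + t))%N))//.
    by rewrite mulSn addnC leq_add2r leq_addr.
  by rewrite leq_mul2r ir orbT.
move=> j; have := zP (Ordinal (ir : (i.+1 < r.+1)%N)) j.
by rewrite NS.
Qed.

End periodic_orbits.

(** * Generic points *)

Section lower_bound.
Context {R : realType} {m : nat} {beta : R} {beta_gt1 : 1 < beta}.
Variable X : subshift m beta_gt1.
Local Notation f := (subshift_map X).
Local Notation windows P := {set {ffun 'I_P -> 'I_m}}.

Let beta_gt0 : 0 < beta. Proof. exact: lt_trans beta_gt1. Qed.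

(** Up to time [k], the orbit of [x] spends in each set of [s] a proportion at
    least [(1 - 1 / M.+1) / size s] of its time; the inequality is multiplied out so
    as to stay in the natural numbers. *)
Definition equidistributed P (s : seq (windows P)) (M k : nat) (x : X) : Prop :=
  forall O, O \in s -> (k.+1 * M <= visits k.+1 x O * size s * M.+1)%N.

Definition often_equidistributed P (s : seq (windows P)) M : set X :=
  [set x | {subset s <= orbits X P} ->
     exists k, (M <= k)%N /\ equidistributed s M k x].

Lemma visits_local P k (x y : X) (O : windows P) :
  (forall i, (i < k + P)%N -> coord x i = coord y i) -> visits k x O = visits k y O.
Proof.
move=> xy; apply: eq_bigr => j _; congr (nat_of_bool (_ \in O)).
apply/winP => i iP; rewrite !coord_iter; apply: xy.
by have := ltn_ord j; lia.
Qed.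

Lemma open_often_equidistributed P (s : seq (windows P)) M :
  open (often_equidistributed s M).
Proof.
have [sub|nsub] := pselect {subset s <= orbits X P}; last first.
  rewrite (_ : often_equidistributed _ _ = setT); first exact: openT.
  by apply/seteqP; split=> // x _ /nsub.
rewrite (_ : often_equidistributed _ _ =
  \bigcup_(k in [set k | (M <= k)%N]) [set x | equidistributed s M k x]).
  apply: bigcup_open => k _; apply: (@open_local _ _ _ _ _ (k.+1 + P)) => x y xy eqx O Os.
  by rewrite -(visits_local O xy); exact: eqx.
apply/seteqP; split=> x.
  by move=> /(_ sub)[k [Mk eqx]]; exists k.
by move=> [k Mk eqx] _; exists k.
Qed.

(** This value of [T] is long enough: [a] is the length of the beginning, [t] that of
    a gap, [P] bounds the time lost at the end of a block, and [v] is the number of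
    visits during the block. *)
Lemma block_length (r M P a t T v : nat) : (0 < r)%N ->
  T = (P * M.+1 + (a + t) * M + t * M).+1 -> (T <= v + P)%N ->
  ((a + t + r * (T + t)) * M <= v * r * M.+1)%N.
Proof.
move=> r0 TE le.
have h1 : (T * (r * M.+1) <= (v + P) * (r * M.+1))%N by rewrite leq_mul2r le orbT.
have h2 : ((a + t) * M <= r * ((a + t) * M))%N by rewrite leq_pmull.
have h3 : (r * T = r * (P * M.+1) + r * ((a + t) * M) + r * (t * M) + r)%N.
  by rewrite TE -addn1 !mulnDr muln1.
have e1 : (T * (r * M.+1) = r * (T * M) + r * T)%N by ring.
have e2 : (v * r * M.+1 + P * (r * M.+1) = (v + P) * (r * M.+1))%N by ring.
have e3 : ((a + t + r * (T + t)) * M + P * (r * M.+1) =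
  (a + t) * M + r * (T * M) + r * (t * M) + r * (P * M.+1))%N by ring.
rewrite -(leq_add2r (P * (r * M.+1))) e2 e3; apply: leq_trans h1.
rewrite e1 h3; move: h2; clear.
move: ((a + t) * M)%N (r * (T * M))%N (r * (t * M))%N (r * (P * M.+1))%N => A B C D.
lia.
Qed.

(** Any finite beginning can be continued by long stays of the same length [T] near
    each of the given orbits; when [T] is large, the beginning, the gaps and the
    ends of the blocks take a negligible part of the time. *)
Lemma dense_often_equidistributed t P (s : seq (windows P)) M :
  gap_shadowing X t -> (0 < P)%N -> dense (often_equidistributed s M).
Proof.
move=> spec P0 U [x Ux] oU.
have [e /= e0 xeU] : exists2 e : R, 0 < e & ball x e `<=` U.
  by have := oU; rewrite openE => /(_ x Ux)/nbhs_ballP.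
have [n nP] := @pow_unbounded _ _ beta_gt1 ((diam_bound m beta + 1) / e).
have near_x z : (forall i, (i < n)%N -> coord z i = coord x i) -> U z.
  move=> zx; apply: xeU; rewrite ballEmdist/=.
  have := @mdist_le_coord _ _ _ _ X x z n (fun i lin => esym (zx i lin)).
  move=> /le_lt_trans; apply.
  rewrite ltr_pdivrMr ?exprn_gt0//; move: nP; rewrite ler_pdivrMr//.
  by rewrite mulrC; lra.
have [sub|nsub] := pselect {subset s <= orbits X P}; last first.
  by exists x; split.
pose y i := if pselect (exists y, periodic P y /\ nth finset.set0 s i = orbit_windows P y)
  is left ex then projT1 (cid ex) else x.
have yP i : (i < size s)%N ->
    periodic P (y i) /\ nth finset.set0 s i = orbit_windows P (y i).
  move=> si; rewrite /y; case: pselect => [ex|[]]; first by case: cid.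
  by apply/orbitsP/sub; rewrite mem_nth.
set r := size s in yP.
(* Following [x] beyond time [M] ensures that the final time is at least [M]. *)
pose a := (n + M).+1.
pose T := (P * M.+1 + (a + t) * M + t * M).+1.
have [z [zx zv]] := @shadow_orbits _ _ _ _ _ t P x a T r y spec P0 isT isT
  (fun i ir => proj1 (yP i ir)).
exists z; split.
  by apply: near_x => i lin; apply: zx; rewrite /a ltnS (leq_trans (ltnW lin))// leq_addr.
move=> _; exists (n + M + t + r * (T + t))%N; split.
  by rewrite -!addnA addnCA leq_addr.
move=> O /(nthP finset.set0)[i ir <-]; rewrite (proj2 (yP _ ir)) -/r.
have lev : (T <= visits (a + t + r * (T + t)) z (orbit_windows P (y i)) + P)%N.
  by rewrite addnC -leq_subLR; exact: zv.
by have := block_length (leq_ltn_trans (leq0n _) ir) (erefl T) lev; rewrite /a !addSn.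
Qed.

(** For every finite list of periodic orbits of the same period, an empirical measure
    of a generic point is close, at arbitrarily large times, to the average of the
    invariant measures on these orbits.  There are countably many such lists. *)
Definition generic_points : set X :=
  \bigcap_(i : {P : nat & seq (windows P.+1)} * nat)
    often_equidistributed (projT2 i.1) i.2.

Lemma residual_generic_points t : gap_shadowing X t -> residual generic_points.
Proof.
move=> spec; apply: residual_bigcap => i; split.
  exact: open_often_equidistributed.
exact: dense_often_equidistributed spec _.
Qed.

Lemma generic_equidistributed (x : X) P (s : seq (windows P)) M : (0 < P)%N ->
  generic_points x -> {subset s <= orbits X P} ->
  exists k, (M <= k)%N /\ equidistributed s M k x.
Proof. by case: P s => // P s _ /(_ (existT _ P s, M) Logic.I). Qed.

Lemma empirical_visits P k (x : X) (O : windows P) :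
  empirical f k x [set y : borel X | win P (y : X) \in O] =
  ((visits k.+1 x O)%:R / k.+1%:R)%:E.
Proof.
rewrite empiricalE mulrC; congr (_ / _)%:E; rewrite natr_sum.
apply: eq_bigr => j _; rewrite indicE; congr (nat_of_bool _)%:R.
by apply/idP/idP => [/set_mem|/mem_set].
Qed.

End lower_bound.

Arguments generic_points {R m beta beta_gt1} X _.

(** * Lower bound: measures that separate code words *)

Lemma sum_exclusive (I : finType) (p : pred I) :
  (forall i j, p i -> p j -> i = j) -> (\sum_i p i <= [exists i, p i])%N.
Proof.
move=> inj; case: (pickP p) => [i0 pi0|none]; last by rewrite big1// => i _; rewrite none.
have -> : [exists i, p i] by apply/existsP; exists i0.
rewrite (bigD1 i0)//= pi0 big1// => i; case: (boolP (p i)) => // pi /eqP[].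
exact: inj.
Qed.

(** The orbits are arranged in [n] pairs [O i true], [O i false], and a string of
    bits selects one orbit in each pair. *)
Section code_windows.
Context {R : realType} {m : nat} {beta : R} {beta_gt1 : 1 < beta}.
Variable X : subshift m beta_gt1.
Variables (P n : nat) (O : 'I_n -> bool -> {set {ffun 'I_P -> 'I_m}}).
Hypothesis O_disjoint : forall i b i' b' w,
  w \in O i b -> w \in O i' b' -> i = i' /\ b = b'.
Implicit Types s t : {ffun 'I_n -> bool}.

Definition disagreement s t : {set {ffun 'I_P -> 'I_m}} :=
  [set w | [exists i, (s i != t i) && (w \in O i (s i))]]%SET.

Lemma visits_disagreement_ge k (x : X) s t :
  (\sum_(i | s i != t i) visits k x (O i (s i)) <= visits k x (disagreement s t))%N.
Proof.
rewrite /visits exchange_big/= leq_sum// => j _; rewrite finset.in_set big_mkcond/=.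
set w := win _ _.
rewrite (eq_bigr (fun i => (s i != t i) && (w \in O i (s i)) : nat)) => [|i _].
  by apply: sum_exclusive => i i' /andP[_ wi] /andP[_ wi']; case: (O_disjoint wi wi').
by case: (_ != _).
Qed.

Lemma visits_disagreement_le k (x : X) s t :
  (visits k x (disagreement s t) + \sum_i visits k x (O i (t i)) <= k)%N.
Proof.
rewrite /visits exchange_big/= -big_split/= -[leqRHS]card_ord -sum1_card leq_sum// => j _.
rewrite finset.in_set; set w := win _ _.
have [/existsP[i /andP[neq wi]]|_] :=
  boolP [exists i, (s i != t i) && (w \in O i (s i))].
  rewrite big1// => i' _; case: (boolP (w \in _)) => // wi'.
  by have [ii ss] := O_disjoint wi wi'; rewrite ss ii eqxx in neq.
apply: leq_trans (sum_exclusive _) (leq_b1 _) => i i' wi wi'.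
by case: (O_disjoint wi wi').
Qed.

End code_windows.

Section emergence_lower.
Context {R : realType} {m : nat} {beta : R} {beta_gt1 : 1 < beta}.
Variable X : subshift m beta_gt1.
Local Notation f := (subshift_map X).

Let beta_gt0 : 0 < beta. Proof. exact: lt_trans beta_gt1. Qed.

Lemma limn_esup_min_lt (N : nat) (u : 'I_N -> (\bar R)^nat) (a b : R) : a < b ->
  (limn_esup (fun n => \big[mine/+oo]_(j < N) u j n) <= a%:E)%E ->
  exists n1, forall n, (n1 <= n)%N -> exists j, (u j n < b%:E)%E.
Proof.
move=> ab /le_lt_trans/(_ (_ : a%:E < b%:E)%E); rewrite lte_fin => /(_ ab).
move=> /ereal_inf_lt[_ [V [n1 _ n1V] <-]] supV; exists n1 => n n1n.
apply: contrapT => none; move: supV; rewrite ltNge => /negP; apply.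
apply: (@le_trans _ _ (\big[mine/+oo]_(j < N) u j n)%E).
  apply: le_bigmin; first exact: leey.
  by move=> j _; rewrite leNgt; apply/negP => lt; apply: none; exists j.
by apply: ereal_sup_ubound; exists n => //; exact: n1V.
Qed.

(** Membership in a set of windows of length [P] is decided by the first [P]
    symbols, so this set and its complement are at distance at least [beta ^- P].
    Testing the two distances to [mu] against the set and against its complement
    compares the two visit frequencies without a triangle inequality for [W1]. *)
Lemma W1_gap_visits P (B : {set {ffun 'I_P -> 'I_m}}) (x : X) k l
    (mu : probability (borel X) R) (eps : R) :
  (W1 (empirical f k x) mu < eps%:E)%E -> (W1 (empirical f l x) mu < eps%:E)%E ->
  beta ^- P * ((visits k.+1 x B)%:R / k.+1%:R - (visits l.+1 x B)%:R / l.+1%:R)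
    < 2 * eps.
Proof.
move=> Wk Wl.
pose A : set (borel X) := [set y : borel X | win P (y : X) \in B].
have mA : measurable A.
  by apply: (@measurable_local _ _ _ _ _ P) => y z /winP yz; rewrite /A/= yz.
have sep (y z : X) : (A y <-> ~ A z) -> beta ^- P <= mdist y z.
  move=> yz; rewrite leNgt; apply/negP => lt.
  have /winP eq : forall i, (i < P)%N -> coord y i = coord z i.
    move=> i iP; apply/eqP; apply: contraTT lt => neq.
    by rewrite -leNgt (mdist_ge_coord (ltnW iP)).
  by move: yz; rewrite /A/= eq; tauto.
have d0 : 0 <= beta ^- P by rewrite invr_ge0 exprn_ge0// ltW.
have mu_fin : mu A \is a fin_num by exact: fin_num_measure.
have h1 : ((beta ^- P)%:E * (empirical f k x A - mu A) <=
    W1 (empirical f k x) mu)%E.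
  by apply: W1_ge_separated => // y z Ay Az; apply: sep; tauto.
have h2 : ((beta ^- P)%:E * (empirical f l x (~` A) - mu (~` A)) <=
    W1 (empirical f l x) mu)%E.
  apply: W1_ge_separated => //; first exact: measurableC.
  by move=> y z Ay Az; apply: sep; have := EM (A z); rewrite /setC/= in Ay Az; tauto.
move/le_lt_trans: h1 => /(_ _ Wk); move/le_lt_trans: h2 => /(_ _ Wl).
rewrite (probability_setC _ mA) (probability_setC mu mA).
have E j : (empirical f j x : probability (borel X) R) A =
    ((visits j.+1 x B)%:R / j.+1%:R)%:E by exact: empirical_visits.
rewrite !E -(fineK mu_fin) -!EFinB -!EFinM !lte_fin.
set a := _ / _; set b := _ / _; set c := fine _.
lra.
Qed.

(** For each string [s], at a suitable time the orbit of [x] is equidistributed along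
    the orbits selected by [s], and some measure of the family is then close.  If
    strings [s] and [t] at Hamming distance at least [d] shared this measure, the
    windows of the orbits selected by [s] and not by [t] would be visited with
    frequency about 1/8 at the time chosen for [s] and about 0 at the time chosen
    for [t]; these frequencies differ by more than what a measure within
    [2 * eps] of both empirical measures allows.  So the fibers of the choice are
    confined to Hamming balls. *)
Lemma generic_emergence_ge P d N (x : X) (eps : R) : (0 < P)%N -> 0 < eps ->
  64 * eps <= beta ^- P -> (16 * d <= #|orbits X P|)%N ->
  generic_points X x -> emergence_bound f x eps N -> (12 ^ d <= N)%N.
Proof.
move=> P0 e0 small dL xgen [N0 [mu]].
have [->//|d0] := posnP d.
have e2 : eps < 2 * eps by lra.
move=> /(limn_esup_min_lt e2)[n1 close].
pose O (i : 'I_(8 * d)) (b : bool) := nth finset.set0 (enum (orbits X P)) (2 * i + b).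
have idx (i : 'I_(8 * d)) (b : bool) : (2 * i + b < size (enum (orbits X P)))%N.
  rewrite -cardE (leq_trans _ dL)//.
  by have := ltn_ord i; case: b; lia.
have O_orb i b : O i b \in orbits X P by rewrite -mem_enum mem_nth.
have O_disj i b i' b' w : w \in O i b -> w \in O i' b' -> i = i' /\ b = b'.
  move=> wi wi'; have /eqP := orbits_disjoint P0 (O_orb i b) (O_orb i' b') wi wi'.
  rewrite nth_uniq ?enum_uniq// => /eqP eq.
  have [ii ->] : i = i' :> nat /\ b = b' by move: eq; clear; case: b b' => [] [] /=; lia.
  by split=> //; exact: val_inj.
(* With [M >= 31] the frequencies that are compared at the end are at least 31/256
   and at most 1/32, hence differ by more than 1/16. *)
pose M := maxn n1 31.
have ex (s : {ffun 'I_(8 * d) -> bool}) : exists kj : nat * 'I_N,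
    (W1 (empirical f kj.1 x) (mu kj.2) < (2 * eps)%:E)%E /\
    forall i, (kj.1.+1 * M <= visits kj.1.+1 x (O i (s i)) * (8 * d) * M.+1)%N.
  have [|k [Mk eqx]] := @generic_equidistributed _ _ _ _ X x P
      [seq O i (s i) | i <- enum 'I_(8 * d)] M P0 xgen.
    by move=> _ /mapP[i _ ->].
  have [j jP] := close k (leq_trans (leq_maxl _ _) Mk).
  exists (k, j); split=> // i; have := eqx (O i (s i)).
  rewrite size_map size_enum_ord; apply; apply: map_f; exact: mem_enum.
have [kj kjP] := choice ex.
apply: (code_fibers (c := fun s => (kj s).2)) => s t.
case: (kj s) (kj t) (kjP s) (kjP t) => [k j] [l j'] /= [Wk hk] [Wl hl] jj.
subst j'; rewrite ltnNge; apply/negP => dist.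
have := W1_gap_visits (disagreement O s t) Wk Wl.
set vk := visits k.+1 x _; set vl := visits l.+1 x _ => gap.
have up : (31 * k.+1 <= 256 * vk)%N.
  have : (d * (k.+1 * M) <= vk * (8 * d) * M.+1)%N.
    apply: (@leq_trans (hamming s t * (k.+1 * M))); first by rewrite leq_mul2r dist orbT.
    rewrite /hamming -sum_nat_const.
    apply: (@leq_trans (\sum_(i | s i != t i)
        visits k.+1 x (O i (s i)) * (8 * d) * M.+1)%N);
      first by apply: leq_sum => i _; exact: hk.
    rewrite -!big_distrl/= !leq_mul2r; apply/orP; right; apply/orP; right.
    exact: visits_disagreement_ge.
  have -> : (vk * (8 * d) * M.+1 = d * (8 * vk * M.+1))%N by ring.
  rewrite leq_pmul2l// => le; rewrite -(@leq_pmul2r M.+1)//.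
  have h : (31 * M.+1 <= 32 * M)%N by rewrite mulnS -[32%N]/(31.+1) mulSn leq_add2r leq_maxr.
  apply: (@leq_trans (32 * (k.+1 * M))).
    have -> : (31 * k.+1 * M.+1 = k.+1 * (31 * M.+1))%N by ring.
    have -> : (32 * (k.+1 * M) = k.+1 * (32 * M))%N by ring.
    by rewrite leq_mul2l h orbT.
  have -> : (256 * vk * M.+1 = 32 * (8 * vk * M.+1))%N by ring.
  by rewrite leq_mul2l le orbT.
have low : (32 * vl <= l.+1)%N.
  have := visits_disagreement_le O_disj l.+1 x s t; rewrite -/vl.
  set S := (\sum_i _)%N => le.
  have : (8 * d * (l.+1 * M) <= 8 * d * (S * M.+1))%N.
    rewrite -[X in (X * (l.+1 * M))%N]card_ord -sum_nat_const.
    apply: (@leq_trans (\sum_i visits l.+1 x (O i (t i)) * (8 * d) * M.+1)%N).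
      by apply: leq_sum => i _; exact: hl.
    rewrite -!big_distrl/= -/S.
    by have -> : (S * (8 * d) * M.+1 = 8 * d * (S * M.+1))%N by ring.
  rewrite leq_pmul2l ?muln_gt0// => le2.
  have le3 : ((vl + S) * M.+1 <= l.+1 * M.+1)%N by rewrite leq_mul2r le orbT.
  apply: (@leq_trans (vl * M.+1)%N).
    by rewrite mulnC leq_mul2l ltnS leq_maxr orbT.
  move: le2 le3; rewrite mulnDl (mulnS l.+1 M).
  move: (l.+1 * M)%N (S * M.+1)%N (vl * M.+1)%N => A1 A2 A3; lia.
have k0 : 0 < k.+1%:R :> R by [].
have l0 : 0 < l.+1%:R :> R by [].
have upR : 31 / 256 <= vk%:R / k.+1%:R :> R.
  rewrite ler_pdivlMr// mulrAC ler_pdivrMr// -!natrM ler_nat.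
  by rewrite (mulnC vk).
have lowR : vl%:R / l.+1%:R <= 1 / 32 :> R.
  by rewrite ler_pdivrMr// mul1r mulrC ler_pdivlMr// -natrM ler_nat mulnC.
have b0 : 0 < beta ^- P by rewrite invr_gt0 exprn_gt0.
move: upR lowR gap; move: (vk%:R / _) (vl%:R / _) => u w upR lowR gap.
have : beta ^- P * (1 / 16) <= beta ^- P * (u - w) by rewrite ler_pM2l//; lra.
lra.
Qed.

End emergence_lower.

(** * Double exponential growth: lower bound *)

Lemma ln2_bounds (R : realType) : 1 / 2 <= ln (2 : R) <= 1.
Proof.
apply/andP; split.
  have /le_ln1Dx : -1 < - (1 / 2) :> R by lra.
  have -> : 1 + - (1 / 2) = 2^-1 :> R by field.
  by rewrite lnV ?posrE//; lra.
have /le_ln1Dx : -1 < 1 :> R by lra.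
by have -> : 1 + 1 = 2 :> R by ring.
Qed.

(** The worst case is [n = 2]; for [n <= 1] the value is 0, since [ln] vanishes on
    nonpositive numbers. *)
Lemma ln_ln_ge (R : realType) (n : nat) : -1 <= ln (ln (n%:R : R)).
Proof.
have /andP[l2 u2] := ln2_bounds R.
have [n2|n2] := leqP 2 n; last first.
  by rewrite [ln (ln _)]ln0; [lra|rewrite ln_le0// lern1].
have le : ln (2 : R) <= ln n%:R by rewrite ler_ln ?posrE ?ltr0n ?ler_nat// (leq_trans _ n2).
apply: (@le_trans _ _ (ln (2^-1 : R))); first by rewrite lnV ?posrE//; lra.
by rewrite ler_ln ?posrE//; lra.
Qed.

Section lower_growth.
Context {R : realType} {m : nat} {beta : R} {beta_gt1 : 1 < beta}.
Variable X : subshift m beta_gt1.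
Local Notation f := (subshift_map X).

Let beta_gt0 : 0 < beta. Proof. exact: lt_trans beta_gt1. Qed.

(** With windows of length [P = n - s], the lower bound [12 ^ d], with [d] at least
    about [nwords X (P - t) / (16 * P)], gives [ln (ln E) >= log_nwords X n - O(ln n)].
    When there are too few orbits to have [1 <= d], the right-hand side is bounded
    above and the trivial bound [ln_ln_ge] suffices. *)
Lemma emergence_lower_shell t : gap_shadowing X t ->
  exists (c : R) n0, forall n eps (x : X), (n0 <= n)%N ->
  beta ^- n.+1 < eps <= beta ^- n -> generic_points X x ->
  emergence_bound f x eps (emergence f x eps) ->
  log_nwords X n - (c + ln n%:R) <= ln (ln (emergence f x eps)%:R).
Proof.
move=> spec; have [s sP] := @pow_unbounded _ _ beta_gt1 64.
exists (log_nwords X (s + t) + ln 32 + 1), (s + t).+1.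
move=> n eps x stn /andP[lo hi] xgen Eb.
have e0 : 0 < eps by rewrite (lt_trans _ lo)// invr_gt0 exprn_gt0.
pose k := (n - (s + t))%N.
have k0 : (0 < k)%N by rewrite subn_gt0.
have kP : (k + t = n - s)%N by rewrite /k; move: stn; lia.
have sn : (s <= n)%N by move: stn; lia.
have small : 64 * eps <= beta ^- (k + t).
  apply: (@le_trans _ _ (64 * beta ^- n)); first by rewrite ler_pM2l.
  have -> : beta ^- (k + t) = beta ^+ s / beta ^+ n.
    rewrite kP -[in RHS](subnK sn) exprD; field.
    by rewrite !expf_neq0// gt_eqF.
  by rewrite ler_pM2r ?invr_gt0 ?exprn_gt0.
have P0 : (0 < k + t)%N by rewrite addn_gt0 k0.
have words := nwords_le_orbits k0 spec.
set L := #|orbits X (k + t)| in words.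
have L0 : (0 < L)%N.
  by rewrite lt0n; apply/eqP => L0; move: words; rewrite L0 mul0n leqNgt nwords_gt0.
have dL : (16 * (L %/ 16) <= L)%N by rewrite mulnC leq_trunc_div.
have Ege := generic_emergence_ge P0 e0 small dL xgen Eb.
set E := emergence f x eps in Ege *; set d := (L %/ 16)%N in dL Ege.
have n0 : (0 < n)%N by exact: leq_ltn_trans stn.
have lnL : ln (L%:R : R) <= ln 32 + 1 + ln (ln E%:R).
  have [d0|d0] := posnP d.
    have : ln (L%:R : R) <= ln 32.
      rewrite ler_ln ?posrE ?ltr0n// ler_nat.
      by have := ltn_ceil L (isT : (0 < 16)%N); rewrite -/d d0; lia.
    by have := ln_ln_ge R E; lra.
  have lnd : ln (L%:R : R) <= ln 32 + ln d%:R.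
    rewrite -lnM ?posrE ?ltr0n// ler_ln ?posrE ?mulr_gt0 ?ltr0n// -natrM ler_nat.
    by have := ltn_ceil L (isT : (0 < 16)%N); rewrite -/d; move: d0; lia.
  have dE : d%:R <= ln (E%:R : R).
    have ln12 : 1 <= ln (12 : R).
      apply: (@le_trans _ _ (ln (2 ^+ 2))).
        by rewrite lnXn// mulr2n; have /andP[] := ln2_bounds R; lra.
      by rewrite ler_ln ?posrE//; lra.
    apply: (@le_trans _ _ (ln (12 ^ d)%:R)).
      by rewrite natrX lnXn// -[leRHS]mulr_natl ler_peMr.
    by rewrite ler_ln ?posrE ?ltr0n ?expn_gt0 ?ler_nat// (leq_trans _ Ege) ?expn_gt0.
  have : ln (d%:R : R) <= ln (ln E%:R).
    by rewrite ler_ln ?posrE ?ltr0n// (lt_le_trans _ dE) ?ltr0n.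
  lra.
have wk : log_nwords X k <= ln L%:R + ln (n%:R : R).
  rewrite -lnM ?posrE ?ltr0n// ler_ln ?posrE ?nwordsR_gt0 ?mulr_gt0 ?ltr0n//.
  rewrite -natrM ler_nat (leq_trans words)// leq_mul2l kP leq_subr orbT//.
have := log_nwordsD X k (s + t); rewrite subnK ?(ltnW stn)//; lra.
Qed.

End lower_growth.

(** * The emergence of generic points *)

Theorem proposition1p5 (R : realType) (m : nat) (m_ge2 : (2 <= m)%N)
    (beta : R) (beta_gt1 : 1 < beta) (X : subshift m beta_gt1) :
  specification (subshift_map X) ->
  exists2 D : R, has_box_dim X D &
  exists2 A : set X, residual A &
  forall x : X, A x ->
    ln (ln (emergence (subshift_map X) x eps)%:R) / - ln eps
      @[eps --> (0 : R)^'+] --> D.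
Proof.
move=> /specification_gap[t spec].
have growth := fekete (log_nwords_ge0 X) (log_nwordsD X).
set h := limn _ in growth.
exists (h / ln beta).
  have [c [n0 shell]] := covering_number_shell X.
  have lim := growth_exponent beta_gt1 growth shell.
  split; first exact: cvg_limf_esup lim.
  have limN : (- (ln (covering_number X eps)%:R / - ln eps))
      @[eps --> (0 : R)^'+] --> - (h / ln beta) by exact: cvgN lim.
  rewrite /lower_box_dim /limf_einf.
  have -> : (\- @box_ratio R X)%E =
    (fun eps => (- (ln (covering_number X eps)%:R / - ln eps))%:E) by [].
  by rewrite (cvg_limf_esup _ limN) EFinN oppeK.
exists (generic_points X); first exact: residual_generic_points spec.
have [c [n0 lower]] := emergence_lower_shell spec.
have [c' upper] := emergence_upper_shell X.
move=> x xgen.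
apply: (@growth_exponent _ _ (log_nwords X) _ (Num.max c c') (maxn n0 1)) => //.
move=> n eps; rewrite geq_max => /andP[nn0 n1] eps_shell.
have /andP[lo _] := eps_shell.
have [Eb up] := upper n eps x n1 lo.
have low := lower n eps x nn0 eps_shell xgen Eb.
have : c <= Num.max c c' by rewrite le_max lexx.
have : c' <= Num.max c c' by rewrite le_max lexx orbT.
by rewrite ler_norml; lra.
Qed.
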